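(* Let $A = \bigoplus_{k=-n}^n A_k$ be a $\mathbb{Z}$-graded semiprime right faithful associative algebra such that $A = \mathrm{id}(A_{-n})$ and $A = A_0AA_0$. Then $Q_s(A)_0 \cong Q_s(A_0)$, where $Q_s(A)$ is the Martindale symmetric ring of quotients of $A$ and the grading of $Q_s(A)$ is induced by the grading of $A$.
   Context: All algebras are algebras over a fixed associative and commutative ring $\Phi$; associative algebras are not assumed to be unital. Products of submodules denote the $\Phi$-span of the products of elements. $\mathrm{id}(X)$ denotes the two-sided ideal of $A$ generated by $X$. $A$ is right faithful if $Ax = 0$ with $x\in A$ implies $x = 0$. A grading $A = \bigoplus_{k=-n}^n A_k$ is a decomposition into $\Phi$-submodules with $A_kA_l \subseteq A_{k+l}$ (where $A_m=0$ for $|m|>n$). For a semiprime associative algebra $A$, $Q^l_{max}(A)$ denotes the maximal left quotient algebra of $A$, and $Q_s(A)$ denotes the Martindale symmetric algebra (ring) of quotients of $A$, i.e. the set of all $q \in Q^l_{max}(A)$ for which there is an essential ideal $I$ of $A$ with $Iq + qI \subseteq A$; it is unital and contains $A$. Induced grading on $Q_s(A)$: put $H_i := A_iA_{-n}A_{n-i}$ and $H_{ij} := H_iAH_j$ for $i,j \in \{0,\ldots,n\}$. Under the hypotheses of the claim there is a set $\{e_0,\ldots,e_n\}$ of orthogonal idempotents of $Q_s(A)$ with $\sum_i e_i = 1$ and $H_{ij} = e_iAe_j$ for all $i,j$ (one says that the grading of $A$ is induced by $\{e_0,\ldots,e_n\}$). The grading of $Q_s(A)$ induced by that of $A$ is $Q_s(A)_k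 = \bigoplus_{i-j=k} e_iQ_s(A)e_j$; in particular $Q_s(A)_0 = \bigoplus_{i=0}^n e_iQ_s(A)e_i$. *)

(* Defs.v *)
From HB Require Import structures.
From mathcomp Require Import all_boot all_order all_algebra.
From mathcomp Require Import boolp classical_sets functions.

Set Implicit Arguments.
Unset Strict Implicit.
Unset Printing Implicit Defensive.

Import GRing.Theory.
Local Open Scope ring_scope.
Local Open Scope classical_set_scope.

(* Associative algebras, not assumed to be unital; the algebra structures of   *)
(* MathComp are all unital and nontrivial.                                     *)
HB.mixin Record Lmodule_isNuAlgebra (R : comPzRingType) A
    of GRing.Lmodule R A := {
  nmul : A -> A -> A;
  nmulA : associative nmul;
  nmulDl : left_distributive nmul +%R;
  nmulDr : right_distributive nmul +%R;
  nscaleAl : forall (c : R) (x y : A), c *: nmul x y = nmul (c *: x) y;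
  nscaleAr : forall (c : R) (x y : A), c *: nmul x y = nmul x (c *: y)
}.

#[short(type="nuAlgType")]
HB.structure Definition NuAlgebra (R : comPzRingType) :=
  {A of Lmodule_isNuAlgebra R A & GRing.Lmodule R A}.

Notation "x ** y" := (nmul x y) (at level 40, left associativity) : ring_scope.

Section BasicNotions.
Variables (R : comPzRingType) (A : nuAlgType R).
Implicit Types (S T I J M : set A).

Lemma nmul0r (x : A) : 0 ** x = 0.
Proof. by apply: (addIr (0 ** x)); rewrite -nmulDl !add0r. Qed.

Lemma nmulr0 (x : A) : x ** 0 = 0.
Proof. by apply: (addIr (x ** 0)); rewrite -nmulDr !add0r. Qed.

Definition is_submod M :=
  M 0 /\ forall (c : R) x y, M x -> M y -> M (c *: x + y).

Definition is_lideal I := is_submod I /\ forall a x, I x -> I (a ** x).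

Definition is_ideal I :=
  is_submod I /\ forall a x, I x -> I (a ** x) /\ I (x ** a).

Definition prod_sm S T : set A :=
  smallest is_submod [set z | exists x y, [/\ S x, T y & z = x ** y]].

Definition ideal_gen S : set A := smallest is_ideal S.

Definition right_faithful := forall x : A, (forall a, a ** x = 0) -> x = 0.

Definition semiprime := forall I, is_ideal I ->
  (forall x y, I x -> I y -> x ** y = 0) -> I `<=` [set 0].

Definition essential I := forall J, is_ideal J ->
  ~ (J `<=` [set 0]) -> ~ (I `&` J `<=` [set 0]).

Definition dense_lideal I := is_lideal I /\
  forall x y, x != 0 -> exists a, a ** x != 0 /\ I (a ** y).

(* The whole algebra A is a dense left ideal as soon as A is right faithful    *)
(* (see adm_dense); admitting it unconditionally makes Qmax below total.       *)
Definition adm I := dense_lideal I \/ I = setT.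

Lemma dense_setT I : dense_lideal I -> dense_lideal setT.
Proof.
move=> [_ dI]; split=> // x y /(dI x y)[a [ax _]].
by exists a.
Qed.

Lemma adm_dense I : right_faithful -> adm I <-> dense_lideal I.
Proof.
move=> rf; split=> [[//|->]|]; last by left.
split=> // x y x0; apply: contrapT => nex; case/eqP: x0; apply: rf => a.
by apply/eqP; apply/negPn/negP => ax; apply: nex; exists a.
Qed.

Lemma adm_setT : adm setT. Proof. by right. Qed.

Lemma adm_lideal I : adm I -> is_lideal I.
Proof. by case=> [[]//|->]. Qed.

End BasicNotions.

(* Left A-module homomorphisms defined on an admissible left ideal; only the   *)
(* values of pfun on pdom matter.                                              *)
Record phom (R : comPzRingType) (A : nuAlgType R) := PHom {
  pdom : set A;
  pfun : A -> A;
  pdom_adm : adm pdom;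
  pfun_lin : forall (c : R) x y, pdom x -> pdom y ->
    pfun (c *: x + y) = c *: pfun x + pfun y;
  pfun_mul : forall a x, pdom x -> pfun (a ** x) = a ** pfun x
}.

HB.instance Definition _ R A := gen_eqMixin (@phom R A).
HB.instance Definition _ R A := gen_choiceMixin (@phom R A).

Section PartialHoms.
#[local] Obligation Tactic := idtac.
Variables (R : comPzRingType) (A : nuAlgType R).
Implicit Types (f g h : phom A) (I J : set A).

Lemma pdom0 f : pdom f 0.
Proof. by case: (adm_lideal (pdom_adm f)) => [[]]. Qed.

Lemma pdom_lin f (c : R) x y : pdom f x -> pdom f y -> pdom f (c *: x + y).
Proof. by case: (adm_lideal (pdom_adm f)) => [[_ H] _]; exact: H. Qed.

Lemma pdom_mul f a x : pdom f x -> pdom f (a ** x).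
Proof. by case: (adm_lideal (pdom_adm f)) => [_ H]; exact: H. Qed.

Lemma pfun0 f : pfun f 0 = 0.
Proof.
have /= := pfun_lin 1 (pdom0 f) (pdom0 f).
by rewrite !scale1r addr0 => /eqP; rewrite -subr_eq subrr => /eqP.
Qed.

Lemma adm_preim f J : adm J -> adm (pdom f `&` pfun f @^-1` J).
Proof.
move=> [dJ|->]; last by rewrite preimage_setT setIT; exact: pdom_adm.
have [[J0 Jlin] Jmul] := dJ.1.
have dI : dense_lideal (pdom f).
  by case: (pdom_adm f) => // ->; exact: dense_setT dJ.
left; split.
  split.
    split; first by split; [exact: pdom0|rewrite /preimage /= pfun0].
    move=> c x y [Ix Jx] [Iy Jy]; split; first exact: pdom_lin.
    by rewrite /preimage /= pfun_lin//; exact: Jlin.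
  move=> a x [Ix Jx]; split; first exact: pdom_mul.
  by rewrite /preimage /= pfun_mul//; exact: Jmul.
move=> x y x0.
have [a [ax Iay]] := dI.2 _ y x0.
have [b [bax Jb]] := dJ.2 _ (pfun f (a ** y)) ax.
exists (b ** a); rewrite -nmulA; split=> //; rewrite -nmulA.
split; first exact: pdom_mul.
by rewrite /preimage /= pfun_mul.
Qed.

Definition pone : phom A :=
  @PHom R A setT id (adm_setT A) (fun _ _ _ _ _ => erefl)
    (fun _ _ _ => erefl).

Lemma admI I J : adm I -> adm J -> adm (I `&` J).
Proof.
move=> aI aJ.
pose f := @PHom R A I id aI (fun _ _ _ _ _ => erefl) (fun _ _ _ => erefl).
exact: (adm_preim f aJ).
Qed.

Program Definition pzero : phom A := @PHom R A setT (fun=> 0) (adm_setT A) _ _.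
Next Obligation. by move=> c x y _ _ /=; rewrite scaler0 addr0. Qed.
Next Obligation. by move=> a x _ /=; rewrite nmulr0. Qed.

Program Definition padd f g : phom A :=
  @PHom R A (pdom f `&` pdom g) (fun x => pfun f x + pfun g x)
    (admI (pdom_adm f) (pdom_adm g)) _ _.
Next Obligation.
by move=> f g c x y [? ?] [? ?] /=; rewrite !pfun_lin// scalerDr addrACA.
Qed.
Next Obligation. by move=> f g a x [? ?] /=; rewrite !pfun_mul// nmulDr. Qed.

Program Definition pscale (c : R) f : phom A :=
  @PHom R A (pdom f) (fun x => c *: pfun f x) (pdom_adm f) _ _.
Next Obligation.
by move=> c f d x y ? ? /=; rewrite pfun_lin// scalerDr !scalerA [c * d]mulrC.
Qed.
Next Obligation. by move=> c f a x ? /=; rewrite pfun_mul// nscaleAr. Qed.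

(* Homomorphisms of left modules are written on the right: pmul f g is first   *)
(* f, then g, which makes pemb below multiplicative.                           *)
Program Definition pmul f g : phom A :=
  @PHom R A (pdom f `&` pfun f @^-1` pdom g) (fun x => pfun g (pfun f x))
    (adm_preim f (pdom_adm g)) _ _.
Next Obligation. by move=> f g c x y [? ?] [? ?] /=; rewrite !pfun_lin. Qed.
Next Obligation. by move=> f g a x [? ?] /=; rewrite !pfun_mul. Qed.

Program Definition pemb (a : A) : phom A :=
  @PHom R A setT (fun x => x ** a) (adm_setT A) _ _.
Next Obligation. by move=> a c x y _ _ /=; rewrite nmulDl nscaleAl. Qed.
Next Obligation. by move=> a b x _ /=; rewrite nmulA. Qed.

Definition peqv f g := exists K : set A,
  [/\ adm K, K `<=` pdom f, K `<=` pdom g & {in K, pfun f =1 pfun g}].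

Lemma peqv_refl f : peqv f f.
Proof. by exists (pdom f); split=> //; exact: pdom_adm. Qed.

Lemma peqv_sym f g : peqv f g -> peqv g f.
Proof. by move=> [K [aK Kf Kg E]]; exists K; split=> // x /E. Qed.

Lemma peqv_trans g f h : peqv f g -> peqv g h -> peqv f h.
Proof.
move=> [K [aK Kf Kg E]] [L [aL Lg Lh E']]; exists (K `&` L).
split; [exact: admI|by move=> x [/Kf]|by move=> x [_ /Lh]|].
by move=> x; rewrite inE => -[Kx Lx]; rewrite E ?E' ?inE.
Qed.

Lemma peqvI f g : (forall x, pdom f x -> pdom g x -> pfun f x = pfun g x) ->
  peqv f g.
Proof.
move=> E; exists (pdom f `&` pdom g).
split; [exact: admI (pdom_adm f) (pdom_adm g)|by move=> ? []|by move=> ? []|].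
by move=> x; rewrite inE => -[]; exact: E.
Qed.

Lemma padd_eqv f f' g g' : peqv f f' -> peqv g g' ->
  peqv (padd f g) (padd f' g').
Proof.
move=> [K [aK Kf Kf' E]] [L [aL Lg Lg' E']]; exists (K `&` L).
split; [exact: admI|by move=> x [/Kf ? /Lg]|by move=> x [/Kf' ? /Lg']|].
by move=> x; rewrite inE => -[Kx Lx] /=; rewrite E ?E' ?inE.
Qed.

Lemma pscale_eqv c f f' : peqv f f' -> peqv (pscale c f) (pscale c f').
Proof.
move=> [K [aK Kf Kf' E]]; exists K; split=> // x Kx /=.
by rewrite E.
Qed.

Lemma pmul_eqv f f' g g' : peqv f f' -> peqv g g' ->
  peqv (pmul f g) (pmul f' g').
Proof.
move=> [K [aK Kf Kf' E]] [L [aL Lg Lg' E']].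
exists (K `&` (pdom f `&` pfun f @^-1` L)); split.
- exact: admI (adm_preim f aL).
- by move=> x [Kx [fx Lx]]; split=> //; exact: Lg.
- move=> x [Kx [fx Lx]]; split; first exact: Kf'.
  by rewrite /preimage /= -E ?inE//; exact: Lg'.
- by move=> x; rewrite inE => -[Kx [fx Lx]] /=; rewrite -E ?inE// E' ?inE.
Qed.

Definition peqvb f g : bool := `[< peqv f g >].

Lemma peqvb_refl : reflexive peqvb.
Proof. by move=> f; apply/asboolP; exact: peqv_refl. Qed.

Lemma peqvb_sym : symmetric peqvb.
Proof. by move=> f g; apply/asboolP/asboolP; exact: peqv_sym. Qed.

Lemma peqvb_trans : transitive peqvb.
Proof.
by move=> f g h /asboolP fg /asboolP gh; apply/asboolP; exact: peqv_trans gh.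
Qed.

Canonical peqv_equiv := EquivRel peqvb peqvb_refl peqvb_sym peqvb_trans.

End PartialHoms.

(* The maximal left quotient algebra: the direct limit of the Hom_A(I, A),     *)
(* where I runs over the dense left ideals of A.                               *)
Definition Qmax (R : comPzRingType) (A : nuAlgType R) :=
  {eq_quot (@peqv_equiv R A)}%qT.

HB.instance Definition _ R (A : nuAlgType R) := Choice.on (Qmax A).
HB.instance Definition _ R (A : nuAlgType R) := EqQuotient.on (Qmax A).

Section MaximalLeftQuotientAlgebra.
Variables (R : comPzRingType) (A : nuAlgType R).
Implicit Types (f g h : phom A) (p q r : Qmax A).

Definition qcls f : Qmax A := \pi_(Qmax A)%qT f.

Lemma qclsP f g : qcls f = qcls g <-> peqv f g.
Proof.
split=> [/eqP|fg]; last by apply/eqP; rewrite /qcls eqmodE; apply/asboolP.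
by rewrite /qcls eqmodE => /asboolP.
Qed.

Lemma qclsI f g : (forall x, pdom f x -> pdom g x -> pfun f x = pfun g x) ->
  qcls f = qcls g.
Proof. by move=> E; apply/qclsP; exact: peqvI. Qed.

Lemma qcls_repr q : qcls (repr q) = q.
Proof. by rewrite /qcls reprK. Qed.

Lemma qcls_ind (P : Qmax A -> Prop) : (forall f, P (qcls f)) -> forall q, P q.
Proof. by move=> H q; rewrite -(qcls_repr q). Qed.

Definition qadd p q := qcls (padd (repr p) (repr q)).
Definition qscale (c : R) q := qcls (pscale c (repr q)).
Definition qmul p q := qcls (pmul (repr p) (repr q)).

Lemma qaddE f g : qadd (qcls f) (qcls g) = qcls (padd f g).
Proof. by apply/qclsP/padd_eqv; apply/qclsP; exact: qcls_repr. Qed.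

Lemma qscaleE c f : qscale c (qcls f) = qcls (pscale c f).
Proof. by apply/qclsP/pscale_eqv; apply/qclsP; exact: qcls_repr. Qed.

Lemma qmulE f g : qmul (qcls f) (qcls g) = qcls (pmul f g).
Proof. by apply/qclsP/pmul_eqv; apply/qclsP; exact: qcls_repr. Qed.

Fact qaddA : associative qadd.
Proof.
elim/qcls_ind=> f; elim/qcls_ind=> g; elim/qcls_ind=> h.
by rewrite !qaddE; apply: qclsI => x _ _ /=; rewrite addrA.
Qed.

Fact qaddC : commutative qadd.
Proof.
elim/qcls_ind=> f; elim/qcls_ind=> g.
by rewrite !qaddE; apply: qclsI => x _ _ /=; rewrite addrC.
Qed.

Fact qadd0 : left_id (qcls (pzero A)) qadd.
Proof.
by elim/qcls_ind=> f; rewrite qaddE; apply: qclsI => x _ _ /=; rewrite add0r.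
Qed.

Fact qaddN : left_inverse (qcls (pzero A)) (qscale (-1)) qadd.
Proof.
elim/qcls_ind=> f; rewrite qscaleE qaddE; apply: qclsI => x _ _ /=.
by rewrite scaleN1r addNr.
Qed.

Fact qmulA : associative qmul.
Proof.
elim/qcls_ind=> f; elim/qcls_ind=> g; elim/qcls_ind=> h.
by rewrite !qmulE; apply: qclsI.
Qed.

Fact qmul1l : left_id (qcls (pone A)) qmul.
Proof. by elim/qcls_ind=> f; rewrite qmulE; apply: qclsI. Qed.

Fact qmul1r : right_id (qcls (pone A)) qmul.
Proof. by elim/qcls_ind=> f; rewrite qmulE; apply: qclsI. Qed.

Fact qmulDl : left_distributive qmul qadd.
Proof.
elim/qcls_ind=> f; elim/qcls_ind=> g; elim/qcls_ind=> h.
rewrite !(qaddE, qmulE); apply: qclsI => x [/= _ _] [[/= _ fx] [/= _ gx]].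
by have := pfun_lin 1 fx gx; rewrite !scale1r.
Qed.

Fact qmulDr : right_distributive qmul qadd.
Proof.
elim/qcls_ind=> f; elim/qcls_ind=> g; elim/qcls_ind=> h.
by rewrite !(qaddE, qmulE); apply: qclsI.
Qed.

HB.instance Definition _ := GRing.isZmodule.Build (Qmax A)
  qaddA qaddC qadd0 qaddN.
HB.instance Definition _ := GRing.Zmodule_isPzRing.Build (Qmax A)
  qmulA qmul1l qmul1r qmulDl qmulDr.

Fact qscaleA (c d : R) q : qscale c (qscale d q) = qscale (c * d) q.
Proof.
elim/qcls_ind: q => f; rewrite !qscaleE; apply: qclsI => x _ _ /=.
by rewrite scalerA.
Qed.

Fact qscale1 : left_id 1 qscale.
Proof.
by elim/qcls_ind=> f; rewrite qscaleE; apply: qclsI => x _ _ /=; rewrite scale1r.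
Qed.

Fact qscaleDr : right_distributive qscale +%R.
Proof.
move=> c; elim/qcls_ind=> f; elim/qcls_ind=> g.
rewrite /GRing.add /= !(qaddE, qscaleE); apply: qclsI => x _ _ /=.
by rewrite scalerDr.
Qed.

Fact qscaleDl q : {morph qscale^~ q : c d / c + d}.
Proof.
move=> c d; elim/qcls_ind: q => f.
rewrite [RHS]/GRing.add /= !(qaddE, qscaleE); apply: qclsI => x _ _ /=.
by rewrite scalerDl.
Qed.

HB.instance Definition _ := GRing.Zmodule_isLmodule.Build R (Qmax A)
  qscaleA qscale1 qscaleDr qscaleDl.

Lemma qscaleAl (c : R) p q : c *: (p * q) = (c *: p) * q.
Proof.
elim/qcls_ind: p => f; elim/qcls_ind: q => g.
rewrite /GRing.scale /GRing.mul /= !(qmulE, qscaleE).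
apply: qclsI => x [/= _ gx] _; have := pfun_lin c gx (pdom0 g).
by rewrite !addr0 pfun0 addr0.
Qed.

Lemma qscaleAr (c : R) p q : c *: (p * q) = p * (c *: q).
Proof.
elim/qcls_ind: p => f; elim/qcls_ind: q => g.
by rewrite /GRing.scale /GRing.mul /= !(qmulE, qscaleE); apply: qclsI.
Qed.

Definition qemb (a : A) : Qmax A := qcls (pemb a).

Lemma qemb_lin (c : R) a b : qemb (c *: a + b) = c *: qemb a + qemb b.
Proof.
rewrite -[RHS]/(qadd (qscale c (qemb a)) (qemb b)) qscaleE qaddE.
by apply: qclsI => x _ _ /=; rewrite nmulDr nscaleAr.
Qed.

Lemma qembM a b : qemb (a ** b) = qemb a * qemb b.
Proof.
rewrite -[RHS]/(qmul (qemb a) (qemb b)) qmulE.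
by apply: qclsI => x _ _ /=; rewrite nmulA.
Qed.

Lemma qemb_inj : right_faithful A -> injective qemb.
Proof.
move=> rf a b /qclsP [K [/adm_dense -/(_ rf) [_ dK] _ _ E]].
apply/eqP; rewrite -subr_eq0; apply/negPn/negP => ab0.
apply/negP: ab0; rewrite negbK; apply/eqP; apply: rf => y.
apply: contrapT => /eqP yab0.
have [c [cyab Kcy]] := dK _ y yab0.
have Eab : c ** y ** a = c ** y ** b by apply: E; rewrite inE.
case/eqP: cyab; rewrite nmulA.
apply: (addIr (c ** y ** b)); rewrite add0r -nmulDr subrK.
exact: Eab.
Qed.

(* The Martindale symmetric algebra of quotients. It is a set rather than a    *)
(* type because its closure under products depends on A being semiprime.       *)
Definition Qs : set (Qmax A) := [set q | exists I : set A,
  [/\ is_ideal I, essential I &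
      forall x, I x -> range qemb (qemb x * q) /\ range qemb (q * qemb x)]].

End MaximalLeftQuotientAlgebra.

Arguments Qs {R} A.
Arguments qemb {R A} a.

(* Isomorphism of R-algebras between subalgebras S and T of Qmax A and Qmax B; *)
(* the values of f outside S are irrelevant.                                   *)
Definition alg_iso (R : comPzRingType) (A B : nuAlgType R)
    (S : set (Qmax A)) (T : set (Qmax B)) : Prop :=
  exists f : Qmax A -> Qmax B,
    [/\ set_bij S T f,
        {in S &, {morph f : x y / x + y}},
        {in S &, {morph f : x y / x * y}} &
        forall c : R, {in S, {morph f : x / c *: x}}].

Record subalgebra (R : comPzRingType) (A : nuAlgType R) := SubAlgebra {
  sacar :> set A;
  sacar_submod : is_submod sacar;
  sacar_mul : forall x y, sacar x -> sacar y -> sacar (x ** y)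
}.

Definition subalg_mem (R : comPzRingType) (A : nuAlgType R)
  (S : subalgebra A) : {pred A} := fun x => x \in sacar S.

Record subalg_type (R : comPzRingType) (A : nuAlgType R) (S : subalgebra A) :=
  SubAlgType { saval :> A; savalP : saval \in subalg_mem S }.

Section SubalgebraStructure.
Variables (R : comPzRingType) (A : nuAlgType R) (S : subalgebra A).

HB.instance Definition _ := [isSub for @saval R A S].
HB.instance Definition _ := [Choice of subalg_type S by <:].

Fact subalg_subsemimod : GRing.subsemimod_closed (subalg_mem S).
Proof.
have [S0 Slin] := sacar_submod S.
rewrite /subalg_mem; split; first split.
- by rewrite unfold_in /= inE.
- move=> x y; rewrite !unfold_in /= !inE => Sx Sy.
  by rewrite -[x]scale1r; exact: Slin.
- move=> c x; rewrite !unfold_in /= !inE => Sx.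
  by rewrite -[c *: x]addr0; exact: Slin.
Qed.

HB.instance Definition _ := GRing.SubChoice_isSubLmodule.Build R A
  (subalg_mem S) (subalg_type S) subalg_subsemimod.

Fact subalg_mulP (x y : subalg_type S) : saval x ** saval y \in subalg_mem S.
Proof.
have := savalP x; have := savalP y.
by rewrite !unfold_in /= !inE => Sy Sx; exact: sacar_mul.
Qed.

Definition subalg_mul (x y : subalg_type S) : subalg_type S :=
  SubAlgType (subalg_mulP x y).

Fact subalg_mulA : associative subalg_mul.
Proof. by move=> x y z; apply: val_inj; exact: nmulA. Qed.

Fact subalg_mulDl : left_distributive subalg_mul +%R.
Proof. by move=> x y z; apply: val_inj; exact: nmulDl. Qed.

Fact subalg_mulDr : right_distributive subalg_mul +%R.
Proof. by move=> x y z; apply: val_inj; exact: nmulDr. Qed.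

Fact subalg_scaleAl (c : R) x y :
  c *: subalg_mul x y = subalg_mul (c *: x) y.
Proof. by apply: val_inj; exact: nscaleAl. Qed.

Fact subalg_scaleAr (c : R) x y :
  c *: subalg_mul x y = subalg_mul x (c *: y).
Proof. by apply: val_inj; exact: nscaleAr. Qed.

HB.instance Definition _ := Lmodule_isNuAlgebra.Build R (subalg_type S)
  subalg_mulA subalg_mulDl subalg_mulDr subalg_scaleAl subalg_scaleAr.

End SubalgebraStructure.

(* The index i < 2n+1 of the sums stands for the degree i - n.                 *)
Record grading (R : comPzRingType) (n : nat) (A : nuAlgType R) := Grading {
  gcomp :> int -> set A;
  gcomp_submod : forall k, is_submod (gcomp k);
  gcomp_mul : forall k l x y, gcomp k x -> gcomp l y -> gcomp (k + l) (x ** y);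
  gcomp_out : forall k : int, (n < `|k|)%N -> gcomp k = [set 0];
  gcomp_sum : forall x, exists2 u : int -> A, (forall k, gcomp k (u k)) &
    x = \sum_(i < n.*2.+1) u (i%:Z - n%:Z);
  gcomp_direct : forall u : int -> A, (forall k, gcomp k (u k)) ->
    \sum_(i < n.*2.+1) u (i%:Z - n%:Z) = 0 -> forall k, u k = 0
}.

Section InducedGrading.
Variables (R : comPzRingType) (n : nat) (A : nuAlgType R) (G : grading n A).

Fact gcomp0_mul x y : G 0 x -> G 0 y -> G 0 (x ** y).
Proof. by move=> Gx Gy; rewrite -[0]addr0; exact: gcomp_mul. Qed.

Definition degree0_subalg : subalgebra A :=
  SubAlgebra (gcomp_submod G 0) gcomp0_mul.

Definition degree0 : nuAlgType R := subalg_type degree0_subalg.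

Definition Hset (i : 'I_n.+1) : set A :=
  prod_sm (prod_sm (G i%:Z) (G (- n%:Z))) (G (n%:Z - i%:Z)).

Definition Hset2 (i j : 'I_n.+1) : set A :=
  prod_sm (prod_sm (Hset i) setT) (Hset j).

Definition induces_grading (e : 'I_n.+1 -> Qmax A) : Prop :=
  [/\ forall i, Qs A (e i),
      forall i, e i * e i = e i,
      forall i j, i != j -> e i * e j = 0,
      \sum_i e i = 1 &
      forall i j, qemb @` Hset2 i j = [set e i * qemb a * e j | a in setT]].

End InducedGrading.

Definition Qs_comp (R : comPzRingType) (n : nat) (A : nuAlgType R)
    (e : 'I_n.+1 -> Qmax A) (k : int) : set (Qmax A) :=
  [set q | exists2 p : 'I_n.+1 -> 'I_n.+1 -> Qmax A,
    (forall i j, Qs A (p i j)) &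
    q = \sum_(i < n.+1) \sum_(j < n.+1 | i%:Z - j%:Z == k) e i * p i j * e j].

(* Main.v *)
Require Import Defs.
From HB Require Import structures.
From mathcomp Require Import all_boot all_order all_algebra.
From mathcomp Require Import zify.
From mathcomp Require Import boolp classical_sets functions.

Set Implicit Arguments.
Unset Strict Implicit.
Unset Printing Implicit Defensive.

Import GRing.Theory.
Local Open Scope ring_scope.
Local Open Scope classical_set_scope.

(** Let B = A_0 and H_i = A_i A_-n A_{n-i}, for 0 <= i <= n.

    Existence of the idempotents. Since A_-n generates A and A = A_0 A A_0, we
    have A = A A_-n A ([extreme_span]); the terms of degree 0 are products of
    A_i, A_-n and A_{n-i}, so B is the sum of the H_i ([degree0_Hsum]). The
    degrees being bounded by n, H_i H_j = 0 for i <> j ([Hset_orth]). Hence A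
    is the sum of the H_i A H_j, and this sum is direct by semiprimeness: an
    element of A H_j is determined by its products with H_j. The projection of
    A on A H_j is a homomorphism of left A-modules defined everywhere, so it is
    right multiplication by an element e_j of the maximal left quotient algebra
    ([peirce_idem]), and these e_j are the required idempotents.

    The isomorphism. For any idempotents e_i inducing the grading, B is the set
    of the elements of A that commute with all e_i ([degree0_centralizer]), and
    Q_s(A)_0 is the set of the elements of Q_s(A) that do ([Qs_comp0]). The
    rest holds for every finite complete system of orthogonal idempotents with
    e_i A e_j <= A ([Qs_centralizer]). An element q of Q_s(A) commuting with the
    e_i and an element q' of Q_s(B) correspond to each other if they act in the
    same way by right multiplication on an essential ideal of B
    ([same_action]).

    From q to q': an essential ideal I of A meets B in an essential ideal of B
    ([essential_restrict]), which q maps into B ([Qs_restrict]).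

    From q' to q: if N is an essential ideal of B that q' maps into B, then q'
    extends to a homomorphism A N -> A ([Qs_extend]), and it has to be shown
    that A N is large. In fact both A N and N A contain one essential two-sided
    ideal of A ([essential_extend]). It is built one idempotent at a time: for
    each j, the k in A with k A e_j <= A N and e_j A k <= N A form an essential
    ideal ([column_ideal_essential]), and an intersection of finitely many
    essential ideals is essential. *)

(** * Semiprimeness and essential ideals *)

Section NonunitalAlgebras.
Variables (R : comPzRingType) (A : nuAlgType R).
Implicit Types (S T I J M : set A) (x y a b : A).

Lemma nmulBl x y a : (x - y) ** a = x ** a - y ** a.
Proof. by apply: (addIr (y ** a)); rewrite -nmulDl !subrK. Qed.

Lemma nmul_suml (I : Type) (s : seq I) (F : I -> A) a :
  (\sum_(i <- s) F i) ** a = \sum_(i <- s) F i ** a.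
Proof. by apply: (big_morph (nmul^~ a)) => [u v|]; rewrite ?nmulDl ?nmul0r. Qed.

Lemma nmul_sumr (I : Type) (s : seq I) (F : I -> A) a :
  a ** (\sum_(i <- s) F i) = \sum_(i <- s) a ** F i.
Proof. by apply: (big_morph (nmul a)) => [u v|]; rewrite ?nmulDr ?nmulr0. Qed.

Lemma submodD M x y : is_submod M -> M x -> M y -> M (x + y).
Proof. by move=> [_ lM] Mx My; rewrite -[x]scale1r; exact: lM. Qed.

Lemma submod_sum M (I : Type) (s : seq I) (P : pred I) (F : I -> A) :
  is_submod M -> (forall i, P i -> M (F i)) -> M (\sum_(i <- s | P i) F i).
Proof.
move=> sM MF; apply: big_ind => //; first by case: sM.
by move=> x y; exact: submodD.
Qed.

Lemma nmul_lin0l (c : R) x y a : x ** a = 0 -> y ** a = 0 ->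
  (c *: x + y) ** a = 0.
Proof. by move=> x0 y0; rewrite nmulDl -nscaleAl x0 y0 scaler0 addr0. Qed.

Lemma nmul_lin0r (c : R) x y a : a ** x = 0 -> a ** y = 0 ->
  a ** (c *: x + y) = 0.
Proof. by move=> x0 y0; rewrite nmulDr -nscaleAr x0 y0 scaler0 addr0. Qed.

Lemma prod_sm_submod S T : is_submod (prod_sm S T).
Proof.
split=> [M [[M0 _] _] //|c x y px py M [sM pM]].
by apply: (sM.2); [apply: px|apply: py].
Qed.

Lemma prod_sm0 S T : prod_sm S T 0.
Proof. by case: (prod_sm_submod S T). Qed.

Lemma prod_sm_mul S T x y : S x -> T y -> prod_sm S T (x ** y).
Proof. by move=> Sx Ty M [_]; apply; exists x, y. Qed.

Lemma prod_sm_sub S T M : is_submod M ->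
  (forall x y, S x -> T y -> M (x ** y)) -> prod_sm S T `<=` M.
Proof.
by move=> sM MST; apply: smallest_sub => // z [x [y [Sx Ty ->]]]; exact: MST.
Qed.

Lemma prod3_sm_sub S T M N : is_submod N ->
  (forall x y z, S x -> T y -> M z -> N (x ** y ** z)) ->
  prod_sm (prod_sm S T) M `<=` N.
Proof.
move=> [N0 Nlin] SN; apply: prod_sm_sub => // x z STx Mz; move: x STx.
apply: prod_sm_sub => [|x y Sx Ty]; last exact: SN.
split=> [|c x y Nx Ny] /=; first by rewrite nmul0r.
by rewrite nmulDl -nscaleAl; exact: Nlin.
Qed.

Lemma lann_submod y : is_submod [set x | x ** y = 0].
Proof. by split=> [|c u v]; [exact: nmul0r|exact: nmul_lin0l]. Qed.

Lemma rann_submod x : is_submod [set y | x ** y = 0].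
Proof. by split=> [|c u v]; [exact: nmulr0|exact: nmul_lin0r]. Qed.

Lemma prod_sm_lmul S T a z : (forall x, S x -> S (a ** x)) ->
  prod_sm S T z -> prod_sm S T (a ** z).
Proof.
move=> Sa; move: z; apply: prod_sm_sub => [|x y Sx Ty].
  have [p0 plin] := prod_sm_submod S T; split; first by rewrite nmulr0.
  by move=> c x y px py; rewrite nmulDr -nscaleAr; exact: plin.
by rewrite nmulA; apply: prod_sm_mul => //; exact: Sa.
Qed.

Lemma prod_sm_rmul S T a z : (forall x, T x -> T (x ** a)) ->
  prod_sm S T z -> prod_sm S T (z ** a).
Proof.
move=> Ta; move: z; apply: prod_sm_sub => [|x y Sx Ty].
  have [p0 plin] := prod_sm_submod S T; split; first by rewrite nmul0r.
  by move=> c x y px py; rewrite nmulDl -nscaleAl; exact: plin.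
by rewrite -nmulA; apply: prod_sm_mul => //; exact: Ta.
Qed.

Lemma is_idealI I J : is_ideal I -> is_ideal J -> is_ideal (I `&` J).
Proof.
move=> [[I0 Ilin] Imul] [[J0 Jlin] Jmul]; split; first split=> //.
  by move=> c x y [Ix Jx] [Iy Jy]; split; [exact: Ilin|exact: Jlin].
by move=> a x [/(Imul a)[? ?] /(Jmul a)[? ?]].
Qed.

Lemma is_ideal_prod I J : is_ideal I -> is_ideal J -> is_ideal (prod_sm I J).
Proof.
move=> [_ Imul] [_ Jmul]; split; first exact: prod_sm_submod.
move=> a x px; split.
  by apply: prod_sm_lmul px => u /(Imul a)[].
by apply: prod_sm_rmul px => u /(Jmul a)[].
Qed.

Lemma prod_sm_subr I J : is_ideal J -> prod_sm I J `<=` J.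
Proof. by move=> [sJ mJ]; apply: prod_sm_sub => // x y _ /(mJ x)[]. Qed.

(** The elements u with u A x = 0 form a two-sided ideal, and so do the
    elements v with u A v = 0 for all these u; the intersection M of the two
    ideals contains x and satisfies M A M = 0. Then M M = 0, because M M lies
    in the ideal of the w in M with w M = 0, whose square is zero. *)
Lemma semiprime_elt : semiprime A ->
  forall x, (forall a, x ** a ** x = 0) -> x = 0.
Proof.
move=> sA x xAx.
pose M : set A := [set u | (forall a, u ** a ** x = 0) /\
  forall y, (forall a, y ** a ** x = 0) -> forall a, y ** a ** u = 0].
have Mx : M x by split.
have idM : is_ideal M.
  split; first split.
  - by split=> [a|y _ a]; rewrite ?nmul0r ?nmulr0.
  - move=> c u v [u1 u2] [v1 v2]; split=> [a|y yx a].
      by rewrite -nmulA nmul_lin0l// nmulA.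
    by rewrite nmul_lin0r// ?u2 ?v2.
  move=> b u [u1 u2]; split; split=> [a|y yx a].
  - by rewrite -!nmulA [u ** _]nmulA u1 nmulr0.
  - by rewrite nmulA -[y ** a ** b]nmulA u2.
  - by rewrite -[u ** b ** a]nmulA u1.
  - by rewrite nmulA u2 // nmul0r.
have MAM u v a : M u -> M v -> u ** a ** v = 0.
  by move=> [u1 _] [_ v2]; exact: v2.
have MM : forall u v, M u -> M v -> u ** v = 0.
  move=> u v Mu Mv.
  apply: (sA [set w | M w /\ forall z, M z -> w ** z = 0]).
  - split; first split.
    + by split=> [|z _]; [case: idM => [[]]|rewrite nmul0r].
    + move=> c p q [Mp p0] [Mq q0]; split=> [|z Mz].
        by case: idM => [[_]] + _; apply.
      by rewrite nmul_lin0l ?p0 ?q0.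
    move=> b p [Mp p0]; have [? ?] := idM.2 b p Mp.
    by split; split=> // z Mz; [rewrite -nmulA p0// nmulr0|exact: MAM].
  - by move=> p q [_ p0] [Mq _]; exact: p0.
  - by split=> [|z Mz]; [case: (idM.2 u v Mv)|exact: MAM].
exact: (sA M).
Qed.

Lemma elt_semiprime : (forall x, (forall a, x ** a ** x = 0) -> x = 0) ->
  semiprime A.
Proof.
move=> eltA I [_ mI] II x Ix; apply: eltA => a.
by apply: II => //; case: (mI a x Ix).
Qed.

Section Semiprime.
Hypothesis sA : semiprime A.

Lemma semiprime_lfaithful x : (forall a, x ** a = 0) -> x = 0.
Proof. by move=> x0; apply: semiprime_elt => // a; rewrite x0 nmul0r. Qed.

Lemma semiprime_rfaithful : right_faithful A.
Proof.
by move=> x x0; apply: semiprime_elt => // a; rewrite -nmulA x0 nmulr0.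
Qed.

Lemma semiprime_neq0 x : x != 0 -> exists a, x ** a ** x != 0.
Proof.
move=> x0; apply: contrapT => nex; case/eqP: x0; apply: semiprime_elt => // a.
by apply/eqP/negPn/negP => ax; apply: nex; exists a.
Qed.

(** The right annihilator J of I is a two-sided ideal, and the square of its
    intersection with I is zero, so that J = 0. *)
Lemma essential_rann I : is_ideal I -> essential I ->
  forall x, (forall y, I y -> y ** x = 0) -> x = 0.
Proof.
move=> iI eI x Ix0.
pose J : set A := [set z | forall y, I y -> y ** z = 0].
have iJ : is_ideal J.
  split; first split=> [y _|c u v Ju Jv y Iy]; first by rewrite nmulr0.
    by rewrite nmul_lin0r ?Ju ?Jv.
  move=> a z Jz; split=> y Iy; last by rewrite nmulA Jz// nmul0r.
  by rewrite nmulA Jz//; case: (iI.2 a y Iy).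
have J0 : J `<=` [set 0].
  apply: contrapT => /(eI J iJ); apply; apply: sA; first exact: is_idealI.
  by move=> u v [Iu _] [_ Jv]; exact: Jv.
exact: J0.
Qed.

Lemma essential_rann_neq0 I : is_ideal I -> essential I ->
  forall x, x != 0 -> exists2 y, I y & y ** x != 0.
Proof.
move=> iI eI x x0; apply: contrapT => nex; case/eqP: x0.
apply: (essential_rann iI eI) => y Iy.
by apply/eqP/negPn/negP => xyx; apply: nex; exists y.
Qed.

(** Take y in I with z = y x nonzero, then a with z a z nonzero: a y in I is
    suitable, since z a z = y (x (a y) x). *)
Lemma essential_neq0 I : is_ideal I -> essential I ->
  forall x, x != 0 -> exists2 y, I y & x ** y ** x != 0.
Proof.
move=> iI eI x x0.
have [y Iy yx0] := essential_rann_neq0 iI eI x0.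
have [a ya] := semiprime_neq0 yx0.
exists (a ** y); first by case: (iI.2 a y Iy).
apply: contraNneq ya => E.
by rewrite -2!nmulA [a ** _]nmulA [x ** _]nmulA E nmulr0.
Qed.

End Semiprime.

(** If J meets I trivially, then I J = 0. *)
Lemma rann_essential I : is_ideal I ->
  (forall x, x != 0 -> exists2 y, I y & y ** x != 0) -> essential I.
Proof.
move=> iI annI J iJ nJ IJ; apply: nJ => x Jx.
apply/eqP/negPn/negP => /annI[y Iy]; apply/negP; rewrite negbK; apply/eqP.
by apply: IJ; split; [case: (iI.2 x y Iy)|case: (iJ.2 y x Jx)].
Qed.

Lemma essentialI I J : is_ideal J ->
  essential I -> essential J -> essential (I `&` J).
Proof.
move=> iJ eI eJ K iK /(eJ K iK) nJK; rewrite -setIA.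
by apply: eI => //; exact: is_idealI.
Qed.

Lemma essential_setT : essential [set: A].
Proof. by move=> J _; rewrite setTI. Qed.

Lemma essential_prod I J : semiprime A -> is_ideal I -> is_ideal J ->
  essential I -> essential J -> essential (prod_sm I J).
Proof.
move=> sA iI iJ eI eJ; apply: rann_essential; first exact: is_ideal_prod.
move=> x /(essential_rann_neq0 sA iJ eJ)[y Jy].
move=> /(essential_rann_neq0 sA iI eI)[z Iz zyx].
by exists (z ** y); [exact: prod_sm_mul|rewrite -nmulA].
Qed.

Lemma ideal_dense I : semiprime A -> is_ideal I -> essential I ->
  dense_lideal I.
Proof.
move=> sA iI eI; split; first by split; [exact: iI.1|move=> a x /(iI.2 a)[]].
move=> x y /(essential_rann_neq0 sA iI eI)[a Ia ax].
by exists a; split=> //; case: (iI.2 y a Ia).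
Qed.

End NonunitalAlgebras.

Lemma essential_bigI (R : comPzRingType) (A : nuAlgType R) (I : finType)
    (F : I -> set A) :
  (forall i, is_ideal (F i)) -> (forall i, essential (F i)) ->
  is_ideal [set x | forall i, F i x] /\ essential [set x | forall i, F i x].
Proof.
move=> iF eF.
have iFs (s : seq I) : is_ideal [set x | forall i, i \in s -> F i x].
  split; first split=> [i _|c x y Fx Fy i si]; first by case: (iF i) => [[]].
    by case: (iF i) => [[_]] + _; apply; [exact: Fx|exact: Fy].
  by move=> a x Fx; split=> i si; case: ((iF i).2 a x (Fx i si)).
have eFs (s : seq I) : essential [set x | forall i, i \in s -> F i x].
  elim: s => [|j s IHs].
    rewrite (_ : [set x | _] = setT); first exact: essential_setT.
    by apply/seteqP; split.
  rewrite (_ : [set x | _] = F j `&` [set x | forall i, i \in s -> F i x]).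
    exact: essentialI.
  apply/seteqP; split=> [x Fx|x [Fjx Fx] i].
    by split=> [|i si]; apply: Fx; rewrite inE ?eqxx ?si ?orbT.
  by rewrite inE => /orP[/eqP->|/Fx].
rewrite (_ : [set x | _] = [set x | forall i, i \in enum I -> F i x]).
  by split; [exact: iFs|exact: eFs].
by apply/seteqP; split=> [x Fx i _|x Fx i]; apply: Fx; rewrite ?mem_enum.
Qed.

(** * The maximal left quotient algebra and the Martindale symmetric one *)

HB.instance Definition _ (R : comPzRingType) (A : nuAlgType R) :=
  GRing.isLinear.Build R A (Qmax A) *:%R (@qemb R A) (@qemb_lin R A).

Lemma qemb0 (R : comPzRingType) (A : nuAlgType R) : qemb (0 : A) = 0.
Proof. exact: raddf0. Qed.

Lemma qemb_sum (R : comPzRingType) (A : nuAlgType R) (I : Type) (s : seq I)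
    (P : pred I) (F : I -> A) :
  qemb (\sum_(i <- s | P i) F i) = \sum_(i <- s | P i) qemb (F i).
Proof. exact: raddf_sum. Qed.

Section QuotientAlgebra.
Variables (R : comPzRingType) (A : nuAlgType R).
Hypothesis sA : semiprime A.
Implicit Types (p q : Qmax A) (I D : set A).

Let rfA : right_faithful A := semiprime_rfaithful sA.

Lemma qemb_pfun (f : phom A) d : pdom f d -> qemb d * qcls f = qemb (pfun f d).
Proof.
move=> fd; rewrite -[LHS]/(qmul (qemb d) (qcls f)) qmulE.
by apply: qclsI => x _ _ /=; rewrite pfun_mul.
Qed.

(** For d in D and in the domains of representatives f of p and g of q, the
    products d p and d q are the values f d and g d in A; so f and g agree on
    a dense left ideal. *)
Lemma dense_qmul_inj D p q : dense_lideal D ->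
  (forall d, D d -> qemb d * p = qemb d * q) -> p = q.
Proof.
move=> dD; elim/qcls_ind: p => f; elim/qcls_ind: q => g E.
apply/qclsP; exists (D `&` (pdom f `&` pdom g)); split.
- by apply: admI; [left|exact: admI (pdom_adm f) (pdom_adm g)].
- by move=> x [_ []].
- by move=> x [_ []].
move=> x; rewrite inE => -[Dx [fx gx]]; apply: (qemb_inj rfA).
by rewrite -!qemb_pfun // E.
Qed.

Lemma qmul_inj p q : (forall x, qemb x * p = qemb x * q) -> p = q.
Proof.
move=> E; apply: (@dense_qmul_inj setT) => //.
exact: (adm_dense setT rfA).1 (adm_setT A).
Qed.

Lemma dense_qmul_eq0 D q : dense_lideal D ->
  (forall d, D d -> qemb d * q = 0) -> q = 0.
Proof.
by move=> dD q0; apply: (dense_qmul_inj dD) => d /q0->; rewrite mulr0.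
Qed.

(** The two sets of multipliers of q into A are submodules, so that an ideal
    spanned by products may be tested on these products. *)
Definition qmulr_range q : set A := [set x | range qemb (q * qemb x)].
Definition qmull_range q : set A := [set x | range qemb (qemb x * q)].

Lemma qmulr_range_submod q : is_submod (qmulr_range q).
Proof.
split=> [|c x y [u _ uE] [v _ vE]].
  by exists 0 => //; rewrite !qemb0 mulr0.
by exists (c *: u + v) => //; rewrite !qemb_lin mulrDr -qscaleAr uE vE.
Qed.

Lemma qmull_range_submod q : is_submod (qmull_range q).
Proof.
split=> [|c x y [u _ uE] [v _ vE]].
  by exists 0 => //; rewrite !qemb0 mul0r.
by exists (c *: u + v) => //; rewrite !qemb_lin mulrDl -qscaleAl uE vE.
Qed.

Lemma Qs_lin (c : R) p q : Qs A p -> Qs A q -> Qs A (c *: p + q).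
Proof.
move=> [I [iI eI Ip]] [J [iJ eJ Jq]]; exists (I `&` J).
split; [exact: is_idealI|exact: essentialI|].
move=> x [/Ip[[u _ uE] [v _ vE]] /Jq[[u' _ uE'] [v' _ vE']]]; split.
  by exists (c *: u + u') => //; rewrite !qemb_lin mulrDr -qscaleAr uE uE'.
by exists (c *: v + v') => //; rewrite !qemb_lin mulrDl -qscaleAl vE vE'.
Qed.

Lemma Qs0 : Qs A 0.
Proof.
exists setT; split=> [//||x _]; first exact: essential_setT.
by split; exists 0 => //; rewrite ?mulr0 ?mul0r qemb0.
Qed.

Lemma Qs_sum (I : Type) (s : seq I) (F : I -> Qmax A) :
  (forall i, Qs A (F i)) -> Qs A (\sum_(i <- s) F i).
Proof.
move=> QF; apply: big_ind => //; first exact: Qs0.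
by move=> x y Qx Qy; rewrite -[x]scale1r; exact: Qs_lin.
Qed.

(** If I p, p I, J q and q J lie in A, then the products JI p q and p q JI do:
    J (I p) is contained in J, and (q J) I in I. *)
Lemma Qs_mul p q : Qs A p -> Qs A q -> Qs A (p * q).
Proof.
move=> [I [iI eI Ip]] [J [iJ eJ Jq]]; exists (prod_sm J I).
split; [exact: is_ideal_prod|exact: essential_prod|].
move=> x JIx; split; move: x JIx; apply: prod_sm_sub.
- exact: qmull_range_submod.
- move=> y x Jy /Ip[[u _ uE] _].
  have /Jq[[v _ vE] _] : J (y ** u) by case: (iJ.2 u y Jy).
  by exists v => //; rewrite vE !qembM uE !mulrA.
- exact: qmulr_range_submod.
- move=> x y /Jq[_ [u _ uE]] Iy.
  have /Ip[_ [v _ vE]] : I (u ** y) by case: (iI.2 u y Iy).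
  by exists v => //; rewrite vE !qembM uE !mulrA.
Qed.

End QuotientAlgebra.

(** * The centralizer of a complete system of orthogonal idempotents *)

Section Centralizer.
Variables (R : comPzRingType) (A : nuAlgType R) (I : finType).
Variables (e : I -> Qmax A) (B : subalgebra A).
Hypothesis sA : semiprime A.
Hypothesis idem_e : forall i, e i * e i = e i.
Hypothesis orth_e : forall i j, i != j -> e i * e j = 0.
Hypothesis sum_e : \sum_i e i = 1.
Hypothesis eAe : forall i j a, range qemb (e i * qemb a * e j).
Hypothesis BP : forall a, sacar B a <-> forall i, e i * qemb a = qemb a * e i.

Local Notation Bt := (subalg_type B).
Implicit Types (N : set Bt) (b c : Bt) (x y a d k : A) (p q r : Qmax A).

Let rfA : right_faithful A := semiprime_rfaithful sA.

Definition bemb b : Qmax A := qemb (saval b).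

Lemma bemb_lin (t : R) b c : bemb (t *: b + c) = t *: bemb b + bemb c.
Proof. by rewrite -qemb_lin. Qed.

Lemma bemb0 : bemb 0 = 0. Proof. exact: qemb0. Qed.

Lemma bembM b c : bemb (b ** c) = bemb b * bemb c.
Proof. exact: qembM. Qed.

Lemma bemb_inj : injective bemb.
Proof. by move=> b c E; apply: val_inj; exact: (qemb_inj rfA) E. Qed.

Lemma bemb_comm b i : e i * bemb b = bemb b * e i.
Proof.
by apply: (BP _).1; have := savalP b; rewrite unfold_in /subalg_mem inE.
Qed.

Lemma bembP q : (forall i, e i * q = q * e i) -> range qemb q ->
  exists b, bemb b = q.
Proof.
move=> eq [a _ aE].
have Ba : a \in subalg_mem B.
  by rewrite unfold_in /subalg_mem inE; apply/BP; rewrite aE.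
by exists (SubAlgType Ba).
Qed.

Lemma e_lmul i x : range qemb (e i * qemb x).
Proof.
rewrite -[e i * _]mulr1 -sum_e mulr_sumr.
have /choice[y yE] : forall j, exists y, qemb y = e i * qemb x * e j.
  by move=> j; have [y _] := eAe i j x; exists y.
exists (\sum_j y j) => //; rewrite qemb_sum.
by apply: eq_bigr => j _; rewrite yE.
Qed.

Lemma e_rmul i x : range qemb (qemb x * e i).
Proof.
rewrite -[qemb x * _]mul1r -sum_e mulr_suml.
have /choice[y yE] : forall j, exists y, qemb y = e j * (qemb x * e i).
  by move=> j; have [y _] := eAe j i x; exists y; rewrite mulrA.
exists (\sum_j y j) => //; rewrite qemb_sum.
by apply: eq_bigr => j _; rewrite yE.
Qed.

Lemma corner_comm i q : forall j, e j * (e i * q * e i) = (e i * q * e i) * e j.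
Proof.
move=> j; have [->|ji] := eqVneq j i.
  by rewrite -!mulrA !idem_e !mulrA idem_e.
by rewrite !mulrA orth_e// !mul0r -mulrA orth_e ?mulr0 // eq_sym.
Qed.

Lemma corner_bemb i x : exists b, bemb b = e i * qemb x * e i.
Proof. by apply: bembP => //; exact: corner_comm. Qed.

Lemma e_neq0 q : q != 0 -> exists i, e i * q != 0.
Proof.
move=> q0; apply: contrapT => nex; case/eqP: q0.
rewrite -[q]mul1r -sum_e mulr_suml big1// => i _.
by apply/eqP/negPn/negP => eq0; apply: nex; exists i.
Qed.

Lemma bemb_e b i : exists y, qemb y = e i * bemb b.
Proof. by have [y _ yE] := e_lmul i (saval b); exists y. Qed.

(** For b in B the element y = e_i b = b e_i lies in the corner e_i A e_i, so
    that y A y = b (e_i A e_i) b, and e_i A e_i is contained in B. *)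
Lemma centralizer_semiprime : semiprime Bt.
Proof.
apply: elt_semiprime => b bBb; apply: bemb_inj; rewrite bemb0.
apply/eqP/negPn/negP => /e_neq0[i]; have [y yE] := bemb_e b i.
rewrite -yE; apply/negP; rewrite negbK; apply/eqP.
rewrite (_ : y = 0) ?qemb0//; apply: semiprime_elt => // a.
apply: (qemb_inj rfA); rewrite !qembM yE.
have [c cE] := corner_bemb i a.
rewrite {1}bemb_comm -!mulrA [qemb a * _]mulrA [e i * (_ * _)]mulrA.
rewrite [e i * (_ * _)]mulrA -cE.
by rewrite mulrA -!bembM bBb bemb0 qemb0.
Qed.

Let sB : semiprime Bt := centralizer_semiprime.
Let rfB : right_faithful Bt := semiprime_rfaithful sB.

Lemma bideal_ideal (J : set A) :
  is_ideal J -> is_ideal [set b : Bt | J (saval b)].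
Proof.
move=> [[J0 Jlin] Jmul]; split; first split=> //.
  by move=> t b c /= Jb Jc; exact: Jlin.
by move=> c b /= /(Jmul (saval c)).
Qed.

(** Given b, choose i with y = e_i b nonzero, z in J with w = y z y nonzero
    and t with w t w nonzero. Then m = w t y (z e_i) lies in J and in the
    corner e_i A e_i, hence in B, and m b = w t w. *)
Lemma essential_restrict (J : set A) : is_ideal J -> essential J ->
  essential [set b : Bt | J (saval b)].
Proof.
move=> iJ eJ; apply: rann_essential; first exact: bideal_ideal.
move=> b b0.
have [i eb0] : exists i, e i * bemb b != 0.
  apply: e_neq0; apply: contraNneq b0 => b0.
  by apply/eqP/bemb_inj; rewrite b0 bemb0.
have [y yE] := bemb_e b i.
have y0 : y != 0 by apply: contraNneq eb0 => y0; rewrite -yE y0 qemb0.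
have [z Jz w0] := essential_neq0 sA iJ eJ y0.
have [t wtw] := semiprime_neq0 sA w0.
have [z2 _ z2E] := e_rmul i z.
pose m := y ** z ** y ** t ** y ** z2.
have yei : qemb y * e i = qemb y by rewrite yE bemb_comm -mulrA idem_e.
have eiy : e i * qemb y = qemb y by rewrite yE mulrA idem_e.
have mE : qemb m = e i * qemb m * e i.
  by rewrite /m !qembM !mulrA eiy -!mulrA z2E -mulrA idem_e.
have [c cE] : exists c, bemb c = qemb m.
  by rewrite mE; exact: corner_bemb.
have cm : saval c = m by apply: (qemb_inj rfA); rewrite -cE.
exists c.
  have [_ mJ] := iJ; rewrite /= cm /m.
  have [_ Jyz] := mJ y z Jz.
  by do 4![apply: (fun u v h => (mJ u v h).2)]; case: (mJ y z Jz) => ? _.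
apply: contraNneq wtw => cb; apply/eqP/(qemb_inj rfA); rewrite qemb0.
by rewrite -bemb0 -cb bembM cE /m !qembM z2E -!mulrA -yE.
Qed.

Lemma qemb_image_lin (D : set A) : is_submod D ->
  (qemb @` D) 0 /\ forall (t : R) p q,
    (qemb @` D) p -> (qemb @` D) q -> (qemb @` D) (t *: p + q).
Proof.
move=> [D0 Dlin]; split; first by exists 0; rewrite ?qemb0.
move=> t _ _ [x Dx <-] [y Dy <-]; exists (t *: x + y); last exact: qemb_lin.
exact: Dlin.
Qed.

Section EssentialIdealOfCentralizer.
Variable N : set Bt.
Hypotheses (iN : is_ideal N) (eN : essential N).

Definition AN := prod_sm [set: A] [set saval b | b in N].
Definition NA := prod_sm [set saval b | b in N] [set: A].

Lemma AN_mul a b : N b -> AN (a ** saval b).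
Proof. by move=> Nb; apply: prod_sm_mul => //; exists b. Qed.

Lemma NA_mul a b : N b -> NA (saval b ** a).
Proof. by move=> Nb; apply: prod_sm_mul => //; exists b. Qed.

Lemma AN_lmul a x : AN x -> AN (a ** x).
Proof. exact: prod_sm_lmul. Qed.

Lemma NA_rmul a x : NA x -> NA (x ** a).
Proof. exact: prod_sm_rmul. Qed.

(** As A is the sum of the A e_j and of the e_j A, the intersection J of these
    ideals over all j satisfies J A <= A N and A J <= N A. *)
Definition column_ideal j : set A := [set k | forall a,
  (qemb @` AN) (qemb k * qemb a * e j) /\ (qemb @` NA) (e j * qemb a * qemb k)].

Lemma column_ideal_ideal j : is_ideal (column_ideal j).
Proof.
have [AN0 ANlin] := qemb_image_lin (prod_sm_submod setT [set saval b | b in N]).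
have [NA0 NAlin] := qemb_image_lin (prod_sm_submod [set saval b | b in N] setT).
split; first split=> [a|t x y Jx Jy a].
- by rewrite qemb0 mulr0 !mul0r.
- have [x1 x2] := Jx a; have [y1 y2] := Jy a.
  rewrite qemb_lin !mulrDl mulrDr -!qscaleAl -qscaleAr.
  by split; [exact: ANlin|exact: NAlin].
move=> b k Jk; split=> a; rewrite qembM; split.
- have [[d ANd dE] _] := Jk a.
  by exists (b ** d); [exact: AN_lmul|rewrite qembM dE !mulrA].
- by have [_ ] := Jk (a ** b); rewrite qembM !mulrA.
- by have [+ _] := Jk (b ** a); rewrite qembM !mulrA.
- have [_ [d NAd dE]] := Jk a.
  by exists (d ** b); [exact: NA_rmul|rewrite qembM dE !mulrA].
Qed.

(** Let x be nonzero. If e_j c x is nonzero for some c in A, then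
    b = e_j c x a e_j is a nonzero element of B for some a, and n b is nonzero
    for some n in N. The column ideal contains k = m n e_j c for every m in A,
    because k A e_j = m n (e_j c A e_j) and e_j A k = (e_j A m e_j) n e_j c;
    choose m such that k x is nonzero. If e_j A x = 0, then x A e_j = 0 as well
    by semiprimeness, so that x and the x b are in the column ideal. *)
Lemma column_ideal_essential j : essential (column_ideal j).
Proof.
apply: rann_essential; first exact: column_ideal_ideal.
move=> x x0.
have [[c ecx]|nex] := EM (exists a, e j * qemb a * qemb x != 0).
  have [y _ yE] := e_lmul j c.
  have yx0 : y ** x != 0.
    by apply: contraNneq ecx => yx; rewrite -yE -qembM yx qemb0.
  have [a yxa] := semiprime_neq0 sA yx0.
  have [b bE] := corner_bemb j (y ** x ** a).
  have ey : e j * qemb y = qemb y by rewrite yE mulrA idem_e.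
  have bE' : bemb b = qemb (y ** x ** a) * e j.
    by rewrite bE !qembM !mulrA ey.
  have b0 : b != 0.
    apply: contraNneq yxa => b0; apply/eqP/(qemb_inj rfA).
    rewrite qembM [qemb (y ** x)]qembM -ey.
    by rewrite !mulrA -bE' b0 bemb0 !mul0r qemb0.
  have [d Nd db] := essential_rann_neq0 sB iN eN b0.
  pose z := saval d ** y.
  have zx0 : z ** x != 0.
    apply: contraNneq db => zx; apply/eqP/bemb_inj; rewrite bemb0 bembM bE'.
    by rewrite mulrA /bemb -qembM !nmulA -/z zx nmul0r qemb0 mul0r.
  have [m mzx] : exists m, m ** (z ** x) != 0.
    apply: contrapT => nm; case/eqP: zx0; apply: rfA => m.
    by apply/eqP/negPn/negP => mz; apply: nm; exists m.
  exists (m ** z); last by rewrite -nmulA.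
  move=> a'; split.
    have [f fE] := corner_bemb j (c ** a').
    have Nf : N (d ** f) by case: (iN.2 f d Nd).
    exists (m ** saval (d ** f)); first exact: AN_mul.
    rewrite qembM -/(bemb (d ** f)) bembM fE !qembM -/(bemb d) yE.
    by rewrite -!mulrA.
  have [f fE] := corner_bemb j (a' ** m).
  have Nf : N (f ** d) by case: (iN.2 f d Nd).
  exists (saval (f ** d) ** y); first exact: NA_mul.
  rewrite qembM -/(bemb (f ** d)) bembM fE !qembM -/(bemb d) -!mulrA.
  by rewrite [e j * (bemb d * _)]mulrA bemb_comm -mulrA ey.
have exa a : e j * qemb a * qemb x = 0.
  by apply/eqP/negPn/negP => eax; apply: nex; exists a.
have xae (c : A) : qemb x * qemb c * e j = 0.
  have [y _ yE] := e_rmul j (x ** c).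
  rewrite -qembM -yE (_ : y = 0) ?qemb0//; apply: semiprime_elt => // a.
  apply: (qemb_inj rfA); rewrite !qembM yE qembM qemb0.
  rewrite -!mulrA [qemb a * _]mulrA [e j * (_ * (qemb c * _))]mulrA.
  by rewrite [e j * (_ * _)]mulrA exa mul0r !mulr0.
have [b xbx] := semiprime_neq0 sA x0.
exists (x ** b) => // a; rewrite !qembM; split.
  exists 0; first exact: prod_sm0.
  by rewrite qemb0 -[qemb x * _ * _]mulrA -qembM xae.
exists 0; first exact: prod_sm0.
by rewrite qemb0 mulrA exa mul0r.
Qed.

(** The intersection J of the column ideals is essential and satisfies
    J A <= A N and A J <= N A, so that A J A lies in both A N and N A. *)
Lemma essential_extend : exists K : set A,
  [/\ is_ideal K, essential K, K `<=` AN & K `<=` NA].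
Proof.
have [] := essential_bigI column_ideal_ideal column_ideal_essential.
set J := [set k | _] => iJ eJ.
have JA k a : J k -> AN (k ** a).
  move=> Jk; have /choice[d dP] : forall j, exists d, AN d /\
      qemb d = qemb (k ** a) * e j.
    by move=> j; have [[d ANd dE] _] := Jk j a; exists d; rewrite qembM.
  rewrite (_ : k ** a = \sum_j d j).
    by apply: submod_sum => [|j _]; [exact: prod_sm_submod|case: (dP j)].
  apply: (qemb_inj rfA); rewrite qemb_sum -[LHS]mulr1 -sum_e mulr_sumr.
  by apply: eq_bigr => j _; case: (dP j).
have AJ k a : J k -> NA (a ** k).
  move=> Jk; have /choice[d dP] : forall j, exists d, NA d /\
      qemb d = e j * qemb (a ** k).
    by move=> j; have [_ [d NAd dE]] := Jk j a; exists d; rewrite qembM mulrA.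
  rewrite (_ : a ** k = \sum_j d j).
    by apply: submod_sum => [|j _]; [exact: prod_sm_submod|case: (dP j)].
  apply: (qemb_inj rfA); rewrite qemb_sum -[LHS]mul1r -sum_e mulr_suml.
  by apply: eq_bigr => j _; case: (dP j).
have iAJ : is_ideal (prod_sm setT J) by exact: is_ideal_prod.
exists (prod_sm (prod_sm setT J) setT); split.
- exact: is_ideal_prod.
- apply: essential_prod => //; last exact: essential_setT.
  by apply: essential_prod => //; exact: essential_setT.
- apply: prod_sm_sub => [|x a]; first exact: prod_sm_submod.
  move=> /(prod_sm_subr iJ) Jx _; exact: JA.
- apply: prod_sm_sub => [|x a AJx _]; first exact: prod_sm_submod.
  apply: NA_rmul; move: x AJx; apply: prod_sm_sub => [|b k _ Jk].
    exact: prod_sm_submod.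
  exact: AJ.
Qed.

Lemma AN_dense : dense_lideal AN.
Proof.
have [K [iK eK KAN _]] := essential_extend.
split; first by split; [exact: prod_sm_submod|move=> a x; exact: AN_lmul].
move=> x y /((ideal_dense sA iK eK).2 x y)[a [ax Kay]].
by exists a; split=> //; exact: KAN.
Qed.

Lemma bemb_rann q : (forall b, N b -> bemb b * q = 0) -> q = 0.
Proof.
move=> Nq; apply: (dense_qmul_eq0 sA AN_dense).
apply: prod_sm_sub => [|a _ _ [b Nb <-]]; last first.
  by rewrite qembM -mulrA Nq// mulr0.
split; first by rewrite qemb0 mul0r.
by move=> t x y xq yq; rewrite /= qemb_lin mulrDl -qscaleAl xq yq scaler0 addr0.
Qed.

Lemma bemb_lann x : (forall b, N b -> x ** saval b = 0) -> x = 0.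
Proof.
move=> xN; have [K [iK eK _ KNA]] := essential_extend.
apply/eqP/negPn/negP => /(essential_neq0 sA iK eK)[k /KNA NAk].
case/eqP; suff -> : x ** k = 0 by rewrite nmul0r.
move: k NAk; apply: prod_sm_sub => [|_ a [b Nb <-] _].
  by split=> [|t u v /= xu xv]; rewrite /= ?nmulr0// nmul_lin0r.
by rewrite nmulA xN// nmul0r.
Qed.

End EssentialIdealOfCentralizer.


(** This relation is the graph of the isomorphism. It determines q and q' by
    each other, because an element of either quotient algebra that is
    annihilated by N on the left is zero. *)
Definition same_action q (q' : Qmax Bt) := exists N,
  [/\ is_ideal N, essential N &
      forall b, N b -> exists2 c, bemb b * q = bemb c & qemb b * q' = qemb c].

Lemma same_action_injl q r (q' : Qmax Bt) :
  same_action q q' -> same_action r q' -> q = r.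
Proof.
move=> [N [iN eN Nq]] [M [iM eM Mr]].
have iNM := is_idealI iN iM; have eNM := essentialI iM eN eM.
apply/eqP; rewrite -subr_eq0; apply/eqP; apply: (bemb_rann iNM eNM) => b.
move=> [/Nq[c cE cE'] /Mr[d dE]]; rewrite mulrBr cE dE cE'.
by move=> /(qemb_inj rfB) ->; rewrite subrr.
Qed.

Lemma same_action_injr q (q' r' : Qmax Bt) :
  same_action q q' -> same_action q r' -> q' = r'.
Proof.
move=> [N [iN eN Nq]] [M [iM eM Mr]].
have iNM := is_idealI iN iM; have eNM := essentialI iM eN eM.
apply: (dense_qmul_inj sB (ideal_dense sB iNM eNM)) => b.
move=> [/Nq[c cE cE'] /Mr[d dE dE']]; rewrite cE' dE'; congr qemb.
by apply: bemb_inj; rewrite -cE dE.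
Qed.

Lemma same_action0 : same_action 0 0.
Proof.
exists setT; split=> // [|b _]; first exact: essential_setT.
by exists 0; rewrite mulr0 ?bemb0 ?qemb0.
Qed.

Lemma same_action_lin (t : R) p q (p' q' : Qmax Bt) : same_action p p' ->
  same_action q q' -> same_action (t *: p + q) (t *: p' + q').
Proof.
move=> [N [iN eN Np]] [M [iM eM Mq]]; exists (N `&` M).
split; [exact: is_idealI|exact: essentialI|].
move=> b [/Np[c cE cE'] /Mq[d dE dE']]; exists (t *: c + d).
  by rewrite bemb_lin mulrDr -qscaleAr cE dE.
by rewrite qemb_lin mulrDr -qscaleAr cE' dE'.
Qed.

Lemma same_action_mul p q (p' q' : Qmax Bt) : same_action p p' ->
  same_action q q' -> same_action (p * q) (p' * q').
Proof.
move=> [N [iN eN Np]] [M [iM eM Mq]]; exists (prod_sm M N).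
split; [exact: is_ideal_prod|exact: essential_prod|].
apply: prod_sm_sub; first split=> [|t b c [d dE dE'] [f fE fE']].
- by exists 0; rewrite ?bemb0 ?qemb0 mul0r.
- exists (t *: d + f); rewrite ?bemb_lin ?qemb_lin mulrDl -qscaleAl.
    by rewrite dE fE.
  by rewrite dE' fE'.
move=> b c Mb /Np[d dE dE'].
have /Mq[f fE fE'] : M (b ** d) by case: (iM.2 d b Mb).
exists f; first by rewrite bembM -mulrA [bemb c * _]mulrA dE mulrA -bembM.
by rewrite qembM -mulrA [qemb c * _]mulrA dE' mulrA -qembM.
Qed.

(** If I q and q I lie in A for an essential ideal I of A, then q maps the
    essential ideal N of B formed by the elements of I in B into B, because q
    commutes with the idempotents; this homomorphism N -> B is q'. *)
Lemma Qs_restrict q : Qs A q -> (forall i, e i * q = q * e i) ->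
  exists2 q' : Qmax Bt, Qs Bt q' & same_action q q'.
Proof.
move=> [J [iJ eJ Jq]] eq; pose N : set Bt := [set b | J (saval b)].
have iN : is_ideal N := bideal_ideal iJ.
have eN : essential N := essential_restrict iJ eJ.
have Nr b : N b -> exists c, bemb c = bemb b * q.
  move=> /Jq[bq _]; apply: bembP => // i.
  by rewrite mulrA bemb_comm -!mulrA eq.
have Nl b : N b -> exists c, bemb c = q * bemb b.
  move=> /Jq[_ qb]; apply: bembP => // i.
  by rewrite mulrA eq -!mulrA bemb_comm.
pose f b := xget 0 [set c | bemb c = bemb b * q].
have fE b : N b -> bemb (f b) = bemb b * q.
  by move=> /Nr[c cE]; rewrite /f; case: xgetP => [d -> //|/(_ c)].
have f_lin (t : R) b c : N b -> N c -> f (t *: b + c) = t *: f b + f c.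
  move=> Nb Nc; apply: bemb_inj; rewrite fE; last exact: iN.1.2.
  by rewrite !bemb_lin mulrDl -qscaleAl !fE.
have f_mul c b : N b -> f (c ** b) = c ** f b.
  move=> Nb; apply: bemb_inj; rewrite fE; last by case: (iN.2 c b Nb).
  by rewrite !bembM fE// mulrA.
have dN := ideal_dense sB iN eN.
pose g := @PHom R Bt N f (or_introl dN) f_lin f_mul.
have gE b : N b -> qemb b * qcls g = qemb (f b) by exact: (@qemb_pfun _ _ g).
exists (qcls g); last first.
  by exists N; split=> // b Nb; exists (f b); [rewrite fE|exact: gE].
exists N; split=> // b Nb; split; first by exists (f b) => //; rewrite gE.
have [c cE] := Nl b Nb; exists c => //.
apply: (dense_qmul_inj sB dN) => d Nd.
rewrite mulrA gE// -!qembM; congr qemb; apply: bemb_inj.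
by rewrite !bembM fE// cE mulrA.
Qed.

(** The homomorphism A N -> A sending x to the unique y in A such that
    y n = x (q' n) for all n in N extends q', since it sends sum_k a_k n_k to
    sum_k a_k (n_k q'). The choice of equations on y spares a proof that the
    latter sum depends only on the former. *)
Lemma Qs_extend (q' : Qmax Bt) : Qs Bt q' ->
  exists q, [/\ Qs A q, forall i, e i * q = q * e i & same_action q q'].
Proof.
move=> [N [iN eN Nq']].
pose Y x y := forall b c, N b -> q' * qemb b = qemb c ->
  y ** saval b = x ** saval c.
have Y_inj x y z : Y x y -> Y x z -> y = z.
  move=> xy xz; apply/eqP; rewrite -subr_eq0; apply/eqP.
  apply: (bemb_lann iN eN) => b Nb.
  have [_ [c _ /esym cE]] := Nq' b Nb.
  by rewrite nmulBl (xy _ _ Nb cE) (xz _ _ Nb cE) subrr.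
have Y_lin (t : R) x y x' y' :
    Y x y -> Y x' y' -> Y (t *: x + x') (t *: y + y').
  move=> xy xy' b c Nb cE.
  by rewrite !nmulDl -!nscaleAl (xy _ _ Nb cE) (xy' _ _ Nb cE).
have Y_mul a x y : Y x y -> Y (a ** x) (a ** y).
  by move=> xy b c Nb cE; rewrite -!nmulA (xy _ _ Nb cE).
have Y_q' b (d : Bt) : N b -> qemb b * q' = qemb d -> Y (saval b) (saval d).
  move=> Nb dE b' c Nb' cE.
  apply: (congr1 (@saval R A B) (_ : d ** b' = b ** c)).
  by apply: (qemb_inj rfB); rewrite !qembM -dE -cE mulrA.
pose D := AN N; have dD : dense_lideal D by exact: AN_dense.
have DY x : D x -> exists y, Y x y.
  move: x; apply: prod_sm_sub.
    split=> [|t x x' [y xy] [y' xy']].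
      by exists 0 => b c _ _; rewrite !nmul0r.
    by exists (t *: y + y'); exact: Y_lin.
  move=> a _ _ [b Nb <-]; have [[d _ /esym dE] _] := Nq' b Nb.
  by exists (a ** saval d); apply/Y_mul/Y_q'.
pose f x := xget 0 [set y | Y x y].
have fY x : D x -> Y x (f x).
  by move=> /DY[y xy]; rewrite /f; case: xgetP => [z -> //|/(_ y)].
have f_lin (t : R) x y : D x -> D y -> f (t *: x + y) = t *: f x + f y.
  move=> Dx Dy; apply: Y_inj (fY _ _) _; first exact: dD.1.1.2.
  by apply: Y_lin; exact: fY.
have f_mul a x : D x -> f (a ** x) = a ** f x.
  move=> Dx; apply: Y_inj (fY _ _) _; first exact: dD.1.2.
  by apply: Y_mul; exact: fY.
pose g := @PHom R A D f (or_introl dD) f_lin f_mul.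
have gE x : D x -> qemb x * qcls g = qemb (f x) by exact: (@qemb_pfun _ _ g).
have gN b c : N b -> qemb b * q' = qemb c -> bemb b * qcls g = bemb c.
  move=> Nb cE; apply: qmul_inj => // a.
  have Dab : D (a ** saval b) by exact: AN_mul.
  rewrite mulrA -qembM gE// -qembM; congr qemb.
  by apply: Y_inj (fY _ Dab) _; apply/Y_mul/Y_q'.
have Ng b c : N b -> q' * qemb b = qemb c -> qcls g * bemb b = bemb c.
  move=> Nb cE; apply: (dense_qmul_inj sA dD) => x Dx.
  by rewrite mulrA gE// -!qembM; congr qemb; exact: fY.
exists (qcls g); split.
- have [K [iK eK KAN KNA]] := essential_extend iN eN.
  exists K; split=> // x Kx; split.
    by exists (f x); rewrite ?gE//; exact: KAN.
  move: x {Kx}(KNA x Kx); apply: prod_sm_sub; first exact: qmulr_range_submod.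
  move=> _ a [b Nb <-] _; have [_ [c _ /esym cE]] := Nq' b Nb.
  by exists (saval c ** a); rewrite // !qembM -/(bemb b) mulrA (Ng b c).
- move=> i; apply/eqP; rewrite -subr_eq0; apply/eqP.
  apply: (bemb_rann iN eN) => b Nb; have [[c _ /esym cE] _] := Nq' b Nb.
  have bq := gN b c Nb cE.
  rewrite mulrBr [_ * (_ * e i)]mulrA [_ * (e i * _)]mulrA -bemb_comm.
  by rewrite -mulrA bq bemb_comm subrr.
- exists N; split=> // b Nb; have [[c _ /esym cE] _] := Nq' b Nb.
  by exists c => //; exact: gN.
Qed.

(** Each of q and q' determines the other, and the relation between them is
    compatible with the operations, so that choosing q' for each q gives an
    isomorphism of algebras. *)
Theorem Qs_centralizer :
  alg_iso [set q | Qs A q /\ forall i, e i * q = q * e i] (Qs Bt).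
Proof.
set S := [set q | _].
pose f q := xget 0 [set q' : Qmax Bt | Qs Bt q' /\ same_action q q'].
have fP q : S q -> Qs Bt (f q) /\ same_action q (f q).
  move=> [/Qs_restrict H /H[q' Qq' qq']]; rewrite /f.
  by case: xgetP => [r -> //|/(_ q')]; case.
have fE q (q' : Qmax Bt) : S q -> same_action q q' -> f q = q'.
  by move=> /fP[_]; exact: same_action_injr.
have S_lin (t : R) p q : S p -> S q -> S (t *: p + q).
  move=> [Qp ep] [Qq eq]; split=> [|i]; first exact: Qs_lin.
  by rewrite mulrDr mulrDl -qscaleAr -qscaleAl ep eq.
have S_mul p q : S p -> S q -> S (p * q).
  move=> [Qp ep] [Qq eq]; split=> [|i]; first exact: Qs_mul.
  by rewrite mulrA ep -!mulrA eq.
have S0 : S 0 by split=> [|i]; [exact: Qs0|rewrite mulr0 mul0r].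
have f_lin (t : R) p q : S p -> S q -> f (t *: p + q) = t *: f p + f q.
  move=> Sp Sq; apply: fE; first exact: S_lin.
  by apply: same_action_lin; [exact: (fP p Sp).2|exact: (fP q Sq).2].
exists f; split.
- split=> [q /fP[]//|p q|q' /Qs_extend[q [Qq eq qq']]].
    rewrite !inE => /fP[_ pf] /fP[_ qf] fpq.
    by apply: same_action_injl pf _; rewrite fpq.
  by exists q => //; exact: fE.
- move=> p q; rewrite !inE => Sp Sq.
  by have := f_lin 1 p q Sp Sq; rewrite !scale1r.
- move=> p q; rewrite !inE => Sp Sq; apply: fE; first exact: S_mul.
  by apply: same_action_mul; [exact: (fP p Sp).2|exact: (fP q Sq).2].
- move=> t q; rewrite inE => Sq.
  have := f_lin t q 0 Sq S0; rewrite !addr0 => ->.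
  by rewrite (fE 0 0)// ?addr0//; exact: same_action0.
Qed.

End Centralizer.

(** * Idempotents from a Peirce decomposition *)

Section PeirceIdempotents.
Variables (R : comPzRingType) (A : nuAlgType R) (I : finType) (H : I -> set A).
Hypothesis sA : semiprime A.
Hypothesis orth_H : forall i j x y, i != j -> H i x -> H j y -> x ** y = 0.
(* A is the sum of the H_i A H_j, as an induction principle. *)
Hypothesis span_H : forall P : set A, is_submod P ->
  (forall i j x a y, H i x -> H j y -> P (x ** a ** y)) -> forall x, P x.
Implicit Types (i j k : I) (x y z a h : A).

Let rfA : right_faithful A := semiprime_rfaithful sA.
Local Notation AH j := (prod_sm [set: A] (H j)).

Lemma AH_orth i j y h : i != j -> AH i y -> H j h -> y ** h = 0.
Proof.
move=> ij AHy Hh; move: y AHy; apply: prod_sm_sub; first exact: lann_submod.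
by move=> a x _ Hx; rewrite /= -nmulA (orth_H ij Hx Hh) nmulr0.
Qed.

Lemma AH_eq0 j y : AH j y -> (forall h, H j h -> y ** h = 0) -> y = 0.
Proof.
move=> AHy yH; apply: (semiprime_lfaithful sA) => x; move: x.
apply: span_H; first exact: rann_submod.
move=> i k h a h' Hh _; rewrite /= !nmulA.
suff -> : y ** h = 0 by rewrite !nmul0r.
have [ji|ji] := eqVneq j i; last exact: AH_orth ji AHy Hh.
by apply: yH; rewrite ji.
Qed.

(** The component of x in A H_j is characterized by its products with H_j,
    where the other components vanish. *)
Definition AHcomp j x y := AH j y /\ forall h, H j h -> y ** h = x ** h.

Lemma AHcomp_inj j x y z : AHcomp j x y -> AHcomp j x z -> y = z.
Proof.
move=> [AHy yE] [AHz zE]; apply/eqP; rewrite -subr_eq0; apply/eqP.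
apply: (@AH_eq0 j).
  rewrite -scaleN1r addrC; exact: (prod_sm_submod _ _).2.
by move=> h Hh; rewrite nmulBl yE// zE// subrr.
Qed.

Lemma AHcomp_lin j (t : R) x y x' y' : AHcomp j x y -> AHcomp j x' y' ->
  AHcomp j (t *: x + x') (t *: y + y').
Proof.
move=> [AHy yE] [AHy' yE']; split; first exact: (prod_sm_submod _ _).2.
by move=> h Hh; rewrite !nmulDl -!nscaleAl yE// yE'.
Qed.

Lemma AHcomp_mul j a x y : AHcomp j x y -> AHcomp j (a ** x) (a ** y).
Proof.
move=> [AHy yE]; split; first exact: prod_sm_lmul.
by move=> h Hh; rewrite -!nmulA yE.
Qed.

Lemma AHcomp_delta i j x : AH i x -> AHcomp j x (if i == j then x else 0).
Proof.
move=> AHx; have [<- //|ij] := eqVneq i j.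
split; first exact: prod_sm0.
by move=> h Hh; rewrite (AH_orth ij AHx Hh) nmul0r.
Qed.

Lemma AHcomp_ex j x : exists y, AHcomp j x y.
Proof.
move: x; apply: span_H.
  split=> [|t x x' [y xy] [y' xy']].
    exists 0; split=> //; exact: prod_sm0.
  by exists (t *: y + y'); exact: AHcomp_lin.
move=> i k h a h' _ Hh'; eexists; apply: (@AHcomp_delta k).
exact: prod_sm_mul.
Qed.

Definition proj j x := xget 0 (AHcomp j x).

Lemma projP j x : AHcomp j x (proj j x).
Proof.
by have [y xy] := AHcomp_ex j x; rewrite /proj; case: xgetP => [z -> //|/(_ y)].
Qed.

Lemma proj_lin j (t : R) x y : proj j (t *: x + y) = t *: proj j x + proj j y.
Proof. by apply: AHcomp_inj (projP _ _) _; apply: AHcomp_lin; exact: projP. Qed.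

Lemma proj_mul j a x : proj j (a ** x) = a ** proj j x.
Proof. by apply: AHcomp_inj (projP _ _) _; apply: AHcomp_mul; exact: projP. Qed.

(** Right multiplication by it is the projection of A on A H_j. *)
Definition peirce_idem j : Qmax A :=
  qcls (@PHom R A setT (proj j) (adm_setT A)
    (fun t x y _ _ => proj_lin j t x y) (fun a x _ => proj_mul j a x)).
Local Notation e := peirce_idem.

Lemma peirce_idemE j x : qemb x * e j = qemb (proj j x).
Proof. exact: qemb_pfun. Qed.

Lemma peirce_AH i j x : AH i x ->
  qemb x * e j = if i == j then qemb x else 0.
Proof.
move=> AHx; rewrite peirce_idemE (AHcomp_inj (projP j x) (AHcomp_delta j AHx)).
by case: ifP => // _; rewrite qemb0.
Qed.

Lemma peirce_H i j h : H j h -> e i * qemb h = if i == j then qemb h else 0.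
Proof.
move=> Hh; apply: (qmul_inj sA) => x.
rewrite mulrA peirce_idemE -qembM; have [AHp pE] := projP i x.
case: eqVneq => [ij|ij]; last by rewrite (AH_orth ij AHp Hh) qemb0 mulr0.
by rewrite -qembM pE// ij.
Qed.

Lemma peirce_HAH i j k l x a y : H k x -> H l y ->
  e i * qemb (x ** a ** y) * e j =
  if (i == k) && (l == j) then qemb (x ** a ** y) else 0.
Proof.
move=> Hx Hy; rewrite -nmulA qembM mulrA (peirce_H i Hx).
case: eqVneq => ik /=; last by rewrite !mul0r.
rewrite -mulrA (peirce_AH (i := l)); last exact: prod_sm_mul.
by case: ifP => //; rewrite mulr0.
Qed.

Lemma peirce_mul i j : e i * e j = if i == j then e i else 0.
Proof.
apply: (qmul_inj sA) => x; rewrite mulrA peirce_idemE.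
rewrite (peirce_AH _ (projP i x).1) -peirce_idemE.
by case: ifP => //; rewrite mulr0.
Qed.

Lemma peirce_sum : \sum_i e i = 1.
Proof.
apply: (qmul_inj sA); apply: span_H.
  split=> [|t x y xE yE]; first by rewrite qemb0 !mul0r.
  by rewrite qemb_lin !mulrDl -!qscaleAl xE yE.
move=> i k h a h' _ Hh'; rewrite mulr1 mulr_sumr.
have AHx : AH k (h ** a ** h') by exact: prod_sm_mul.
rewrite (bigD1 k)//= (peirce_AH k AHx) eqxx big1 ?addr0// => j jk.
by rewrite (peirce_AH j AHx) eq_sym (negPf jk).
Qed.

Lemma peirce_Qs i : Qs A (e i).
Proof.
exists setT; split=> // [|x _]; first exact: essential_setT.
split; first by exists (proj i x); rewrite // peirce_idemE.
move: x; apply: span_H; first exact: qmulr_range_submod.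
move=> j k h a h' Hh _; rewrite /qmulr_range /= -nmulA qembM mulrA.
rewrite (peirce_H i Hh); case: ifP => _.
  by exists (h ** (a ** h')); rewrite // qembM.
by exists 0; rewrite // qemb0 mul0r.
Qed.

Lemma peirce_corner i j :
  qemb @` (prod_sm (prod_sm (H i) setT) (H j)) =
  [set e i * qemb a * e j | a in setT].
Proof.
apply/seteqP; split.
  move=> _ [x + <-] /=; move=> HAHx; exists x => //; move: x HAHx.
  apply: prod3_sm_sub; last first.
    by move=> x a y Hx _ Hy; rewrite /= (peirce_HAH _ _ _ Hx Hy) !eqxx.
  split=> [|t x y xE yE] /=; first by rewrite qemb0 mulr0 mul0r.
  by rewrite qemb_lin mulrDr mulrDl -qscaleAr -qscaleAl xE yE.
move=> _ [a _ <-] /=; move: a; apply: span_H.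
  split=> [|t x y [x' Hx' xE] [y' Hy' yE]].
    by exists 0; rewrite ?qemb0 ?mulr0 ?mul0r//; exact: prod_sm0.
  exists (t *: x' + y'); first exact: (prod_sm_submod _ _).2.
  by rewrite !qemb_lin mulrDr mulrDl -qscaleAr -qscaleAl xE yE.
move=> k l x a y Hx Hy; rewrite (peirce_HAH _ _ _ Hx Hy).
case: ifP => [/andP[/eqP ik /eqP lj]|_].
  exists (x ** a ** y) => //; apply: prod_sm_mul; last by rewrite -lj.
  by apply: prod_sm_mul; rewrite ?ik.
by exists 0; rewrite ?qemb0//; exact: prod_sm0.
Qed.

End PeirceIdempotents.

(** * Gradings generated by the extreme component *)

Section Gradings.
Variables (R : comPzRingType) (n : nat) (A : nuAlgType R) (G : grading n A).
Implicit Types (i j : 'I_n.+1) (k l : int) (x y z a b : A).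

Lemma gcomp0 k : G k 0. Proof. by case: (gcomp_submod G k). Qed.

Lemma gcomp_eq0 k x : G k x -> (n < `|k|)%N -> x = 0.
Proof. by move=> Gx /gcomp_out => /(_ R A G) GE; move: Gx; rewrite GE. Qed.

Lemma gcomp_mul_eq k l m x y : G k x -> G l y -> k + l = m -> G m (x ** y).
Proof. by move=> Gx Gy <-; exact: gcomp_mul. Qed.

Lemma gcomp_cast k l x : k = l -> G k x -> G l x. Proof. by move=> ->. Qed.

Definition homog k x := fun l : int => if l == k then x else 0.

Lemma homogP k x l : G k x -> G l (homog k x l).
Proof. by rewrite /homog; case: eqP => [->//|_ _]; exact: gcomp0. Qed.

Lemma homog_sum k x : G k x ->
  x = \sum_(i < n.*2.+1) homog k x (i%:Z - n%:Z).
Proof.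
move=> Gx; have [kn|/(gcomp_eq0 Gx)->] := leqP `|k| n; last first.
  by rewrite big1// => i _; rewrite /homog; case: ifP.
have kE : `|(k + n%:Z)%R|%N%:Z = k + n%:Z by lia.
have kn2 : (`|(k + n%:Z)%R| < n.*2.+1)%N by lia.
rewrite (bigD1 (Ordinal kn2))//= big1 => [|i].
  by rewrite addr0 /homog kE addrK eqxx.
rewrite /homog -val_eqE /= => ik; case: eqP => // ikn; case/eqP: ik.
by lia.
Qed.

(** Compare x, as a family concentrated in degree 0, with its components. *)
Lemma gcomp0_uniq x (u : int -> A) : G 0 x -> (forall k, G k (u k)) ->
  x = \sum_(i < n.*2.+1) u (i%:Z - n%:Z) -> x = u 0.
Proof.
move=> Gx Gu xE; apply/eqP; rewrite -subr_eq0; apply/eqP.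
have /(gcomp_direct (g := G)) direct : forall k, G k (homog 0 x k - u k).
  move=> k; rewrite addrC -scaleN1r; apply: (gcomp_submod G k).2 => //.
  exact: homogP.
have := direct _ 0; rewrite /homog eqxx; apply; rewrite -/(homog 0 x).
by rewrite sumrB -[X in X - _](homog_sum Gx) -xE subrr.
Qed.

Lemma Hset_submod i : is_submod (Hset G i). Proof. exact: prod_sm_submod. Qed.

(** H_i H_j = A_i A_-n (A_{n-i} A_j) A_-n A_{n-j}. The middle factor has degree
    n - i + j, which exceeds n if i < j; if j < i, multiplying it by A_-n on
    both sides leads to the degree - n - i + j, which is less than - n. *)
Lemma Hset_orth i j x y : i != j -> Hset G i x -> Hset G j y -> x ** y = 0.
Proof.
rewrite -val_eqE /= => ij Hx Hy; move: x Hx.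
apply: prod3_sm_sub => [|u v w Gu Gv Gw]; first exact: lann_submod.
move: y Hy; apply: prod3_sm_sub => [|u' v' w' Gu' Gv' Gw'] /=.
  exact: rann_submod.
have [ilj|jli] := ltnP i j.
  rewrite (_ : u ** v ** w ** _ = u ** v ** (w ** u') ** v' ** w'); last first.
    by rewrite !nmulA.
  by rewrite (gcomp_eq0 (gcomp_mul Gw Gu')) ?nmulr0 ?nmul0r//; lia.
rewrite (_ : u ** v ** w ** _ = u ** (v ** (w ** u') ** v') ** w'); last first.
  by rewrite !nmulA.
rewrite (gcomp_eq0 (gcomp_mul (gcomp_mul Gv (gcomp_mul Gw Gu')) Gv')).
  by rewrite nmulr0 nmul0r.
by lia.
Qed.

(** For the same reason, only the component of degree 0 of the middle factor A
    contributes to H_i A H_i. *)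
Lemma Hset2_degree0 i x : Hset2 G i i x -> G 0 x.
Proof.
move: x; apply: prod3_sm_sub; first exact: gcomp_submod.
move=> x a y Hx _ Hy; move: x Hx.
apply: prod3_sm_sub => [|u v w Gu Gv Gw].
  split=> [|t x z Gx Gz] /=; first by rewrite !nmul0r; exact: gcomp0.
  by rewrite !nmulDl -!nscaleAl; exact: (gcomp_submod G 0).2.
move: y Hy; apply: prod3_sm_sub => [|u' v' w' Gu' Gv' Gw'] /=.
  split=> [|t x z Gx Gz] /=; first by rewrite !nmulr0; exact: gcomp0.
  by rewrite !nmulDr -!nscaleAr; exact: (gcomp_submod G 0).2.
have [f Gf ->] := gcomp_sum G a.
rewrite nmul_sumr nmul_suml.
apply: submod_sum => [|m _]; first exact: gcomp_submod.
move: (f _) (Gf (m%:Z - n%:Z)) => c; move: (_ - _) => k Gc.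
have Gwcu := gcomp_mul (gcomp_mul Gw Gc) Gu'.
rewrite (_ : _ ** (u' ** v' ** w') = u ** (v ** (w ** c ** u') ** v') ** w').
  have := gcomp_mul (gcomp_mul Gu (gcomp_mul (gcomp_mul Gv Gwcu) Gv')) Gw'.
  have [k0|k0|->] := Order.TotalTheory.ltgtP k 0; last first.
  - by apply: gcomp_cast; lia.
  - rewrite (gcomp_eq0 Gwcu); last by lia.
    by rewrite nmulr0 nmul0r nmulr0 nmul0r => _; exact: gcomp0.
  - rewrite (gcomp_eq0 (gcomp_mul (gcomp_mul Gv Gwcu) Gv')); last by lia.
    by rewrite nmulr0 nmul0r => _; exact: gcomp0.
by rewrite !nmulA.
Qed.

Section Full.
Hypothesis sA : semiprime A.
Hypothesis A_gen : ideal_gen (G (- n%:Z)) = setT.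
Hypothesis A_full : prod_sm (prod_sm (G 0) setT) (G 0) = setT.

Lemma full_span (P : set A) : is_submod P ->
  (forall x a y, G 0 x -> G 0 y -> P (x ** a ** y)) -> forall x, P x.
Proof.
move=> sP GP x; have : [set: A] x by []; rewrite -A_full; move: x.
by apply: prod3_sm_sub => // x a y Gx _ Gy; exact: GP.
Qed.

(** The elements x with A x A <= A A_-n A form an ideal containing A_-n, hence
    all of A, and A = A_0 A A_0. *)
Lemma extreme_span (P : set A) : is_submod P ->
  (forall a v b, G (- n%:Z) v -> P (a ** v ** b)) -> forall x, P x.
Proof.
move=> sP GP; apply: full_span => // a x b _ _.
suff : ideal_gen (G (- n%:Z)) `<=` [set x | forall a b, P (a ** x ** b)].
  by rewrite A_gen; apply.
apply: smallest_sub => [|v Gv a' b'] /=; last exact: GP.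
split; first split=> [a' b'|t y z Py Pz a' b'].
- by rewrite nmulr0 nmul0r; case: sP.
- by rewrite nmulDr nmulDl -nscaleAr -nscaleAl; exact: sP.2.
by move=> c y Py; split=> a' b'; [rewrite nmulA|rewrite nmulA -nmulA].
Qed.

Definition Hsum : set A := [set x |
  exists2 h : 'I_n.+1 -> A, (forall i, Hset G i (h i)) & x = \sum_i h i].

Lemma Hsum_submod : is_submod Hsum.
Proof.
split=> [|t _ _ [h Hh ->] [h' Hh' ->]].
  by exists (fun=> 0) => [i|]; rewrite ?big1//; case: (Hset_submod i).
exists (fun i => t *: h i + h' i) => [i|]; first exact: (Hset_submod i).2.
by rewrite big_split scaler_sumr.
Qed.

Lemma Hset_Hsum i x : Hset G i x -> Hsum x.
Proof.
move=> Hx; exists (fun j => if j == i then x else 0) => [j|].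
  by case: eqP => [->//|_]; case: (Hset_submod j).
by rewrite -big_mkcond big_pred1_eq.
Qed.

(** By A = A A_-n A, the degree 0 component of any element is a sum of
    products of A_k, A_-n and A_{n-k}, and both A_k and A_{n-k} can be nonzero
    only for 0 <= k <= n. *)
Lemma degree0_Hsum x : G 0 x -> Hsum x.
Proof.
move=> Gx; pose P y := exists2 u : int -> A, (forall k, G k (u k)) /\ Hsum (u 0)
   & y = \sum_(i < n.*2.+1) u (i%:Z - n%:Z).
have sP : is_submod P.
  split=> [|t _ _ [u [Gu Hu] ->] [u' [Gu' Hu'] ->]].
    exists (fun=> 0); last by rewrite big1.
    by split=> [k|]; [exact: gcomp0|case: Hsum_submod].
  exists (fun k => t *: u k + u' k); last by rewrite big_split scaler_sumr.
  by split=> [k|]; [exact: (gcomp_submod G k).2|exact: Hsum_submod.2].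
have P_homog k y : G k y -> (k = 0 -> Hsum y) -> P y.
  move=> Gy Hy; exists (homog k y); last exact: homog_sum.
  split=> [l|]; first exact: homogP.
  by rewrite /homog; case: eqP => [/esym//|_]; case: Hsum_submod.
suff [u [Gu Hu] xE] : P x by rewrite (gcomp0_uniq Gx Gu xE).
move: {Gx} x; apply: extreme_span => // a v b Gv.
have [f Gf ->] := gcomp_sum G a; have [g Gg ->] := gcomp_sum G b.
rewrite !nmul_suml; apply: submod_sum => // i _.
rewrite nmul_sumr; apply: submod_sum => // j _.
move: (f _) (Gf (i%:Z - n%:Z)) => c; move: (_ - _) => k Gc.
move: (g _) (Gg (j%:Z - n%:Z)) => d; move: (_ - _) => l Gd.
apply: P_homog (gcomp_mul (gcomp_mul Gc Gv) Gd) _ => kl.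
have [kn|kn] := boolP ((0 <= k) && (k <= n%:Z)).
  have kn1 : (`|k| < n.+1)%N by lia.
  apply: (@Hset_Hsum (Ordinal kn1)); apply: prod_sm_mul => /=.
    by apply: prod_sm_mul => //; apply: gcomp_cast Gc; lia.
  by apply: gcomp_cast Gd; lia.
have [nk|nk] := ltnP n `|k|%N.
  by rewrite (gcomp_eq0 Gc nk) !nmul0r; case: Hsum_submod.
by rewrite (gcomp_eq0 Gd) ?nmulr0; [case: Hsum_submod|lia].
Qed.

Lemma Hset_span (P : set A) : is_submod P ->
  (forall i j x a y, Hset G i x -> Hset G j y -> P (x ** a ** y)) ->
  forall x, P x.
Proof.
move=> sP HP; apply: full_span => // x a y /degree0_Hsum[h Hh ->].
move=> /degree0_Hsum[h' Hh' ->].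
rewrite !nmul_suml; apply: submod_sum => // i _.
by rewrite nmul_sumr; apply: submod_sum => // j _; exact: HP.
Qed.

Lemma induces_grading_exists : exists e, induces_grading G e.
Proof.
exists (peirce_idem sA Hset_orth Hset_span); split.
- exact: peirce_Qs.
- by move=> i; rewrite peirce_mul eqxx.
- by move=> i j /negPf ij; rewrite peirce_mul ij.
- exact: peirce_sum.
- exact: peirce_corner.
Qed.

Variable e : 'I_n.+1 -> Qmax A.
Hypothesis eG : induces_grading G e.

Lemma induced_corner i j a :
  exists2 z, Hset2 G i j z & qemb z = e i * qemb a * e j.
Proof.
case: eG => _ _ _ _ /(_ i j) HE.
have : [set e i * qemb a * e j | a in setT] (e i * qemb a * e j) by exists a.
by rewrite -HE => -[z Hz zE]; exists z.
Qed.

Lemma induced_eAe i j a : range qemb (e i * qemb a * e j).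
Proof. by have [z _ zE] := induced_corner i j a; exists z. Qed.

Lemma induced_sum : \sum_i e i = 1. Proof. by case: eG. Qed.

(** A e_i = sum_j e_j A e_i lies in A H_i, and H_i H_k = 0. *)
Lemma induced_Hl i (k : 'I_n.+1) x : i != k -> Hset G k x -> e i * qemb x = 0.
Proof.
move=> ik Hx; apply: (qmul_inj sA) => a; rewrite mulr0.
rewrite -[qemb a]mul1r -induced_sum !mulr_suml.
apply: big1 => j _; have [z Hz zE] := induced_corner j i a.
rewrite mulrA -zE -qembM (_ : z ** x = 0) ?qemb0//; move: z Hz {zE}.
apply: prod_sm_sub => [|y h _ Hh]; first exact: lann_submod.
by rewrite /= -nmulA (Hset_orth ik Hh Hx) nmulr0.
Qed.

Lemma induced_Hr i (k : 'I_n.+1) x : i != k -> Hset G k x -> qemb x * e i = 0.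
Proof.
move=> ik Hx; have [y _ yE] := e_rmul induced_sum induced_eAe i x.
rewrite -yE (_ : y = 0) ?qemb0//; apply: (semiprime_lfaithful sA) => a.
apply: (qemb_inj (semiprime_rfaithful sA)); rewrite qembM yE qemb0.
rewrite -[qemb a]mulr1 -induced_sum !mulr_sumr.
apply: big1 => j _; have [z Hz zE] := induced_corner i j a.
rewrite mulrA -[_ * e i * _]mulrA -mulrA -zE -qembM (_ : x ** z = 0) ?qemb0//.
move: z Hz {zE}; apply: prod3_sm_sub => [|h b h' Hh _ _].
  exact: rann_submod.
by rewrite /= !nmulA (Hset_orth _ Hx Hh) ?nmul0r// eq_sym.
Qed.

(** The degree 0 component of A is the Peirce diagonal sum_i e_i A e_i. *)
Lemma degree0_centralizer a :
  sacar (degree0_subalg G) a <-> forall i, e i * qemb a = qemb a * e i.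
Proof.
split=> [/degree0_Hsum[h Hh ->] i|ea].
  rewrite qemb_sum mulr_sumr mulr_suml; apply: eq_bigr => k _.
  have [->|ik] := eqVneq i k; last by rewrite (induced_Hl ik)// (induced_Hr ik).
  rewrite -[LHS]addr0 -[RHS]addr0.
  transitivity (qemb (h k)).
    rewrite -[RHS]mul1r -induced_sum mulr_suml (bigD1 k)//= big1// => j jk.
    exact: induced_Hl jk _.
  rewrite -[LHS]mulr1 -induced_sum mulr_sumr (bigD1 k)//= big1// => j jk.
  exact: induced_Hr jk _.
have /choice[z zP] : forall i, exists z, Hset2 G i i z /\ qemb z = qemb a * e i.
  move=> i; have [z Hz zE] := induced_corner i i a; exists z; split=> //.
  by case: eG => _ idem_e _ _ _; rewrite zE ea -mulrA idem_e.
rewrite (_ : a = \sum_i z i).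
  apply: submod_sum => [|i _]; first exact: gcomp_submod.
  exact: Hset2_degree0 (zP i).1.
apply: (qemb_inj (semiprime_rfaithful sA)); rewrite qemb_sum -[LHS]mulr1.
by rewrite -induced_sum mulr_sumr; apply: eq_bigr => i _; rewrite (zP i).2.
Qed.

Lemma Qs_comp0 :
  Qs_comp e 0 = [set q | Qs A q /\ forall i, e i * q = q * e i].
Proof.
case: eG => Qe idem_e orth_e sum_e _.
have diag (p : 'I_n.+1 -> 'I_n.+1 -> Qmax A) :
    \sum_(i < n.+1) \sum_(j < n.+1 | i%:Z - j%:Z == 0) e i * p i j * e j =
    \sum_i e i * p i i * e i.
  apply: eq_bigr => i _; apply: big_pred1 => j.
  by rewrite subr_eq0 eqz_nat eq_sym.
apply/seteqP; split=> [q [p Qp]|q [Qq eq]].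
  rewrite diag => ->; split=> [|k].
    by apply: Qs_sum => i; apply: Qs_mul => //; exact: Qs_mul.
  rewrite mulr_sumr mulr_suml; apply: eq_bigr => i _.
  exact: (corner_comm idem_e orth_e).
exists (fun _ _ => q) => //; rewrite diag -[LHS]mulr1 -sum_e mulr_sumr.
by apply: eq_bigr => i _; rewrite eq -mulrA idem_e.
Qed.

End Full.
End Gradings.

Theorem theorem2p7 (Phi : comPzRingType) (n : nat) (A : nuAlgType Phi)
    (G : grading n A)
    (semiprime_A : semiprime A)
    (right_faithful_A : right_faithful A)
    (A_gen : ideal_gen (G (- n%:Z)) = setT)
    (A_full : prod_sm (prod_sm (G 0) setT) (G 0) = setT) :
  (exists e : 'I_n.+1 -> Qmax A, induces_grading G e) /\
  (forall e : 'I_n.+1 -> Qmax A, induces_grading G e ->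
     alg_iso (Qs_comp e 0) (Qs (degree0 G))).
Proof.
split=> [|e eG]; first exact: induces_grading_exists.
have [_ idem_e orth_e sum_e _] := eG.
rewrite (Qs_comp0 semiprime_A eG).
apply: Qs_centralizer => //; first exact: induced_eAe eG.
exact: degree0_centralizer.
Qed.
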